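(* Let $A$ be an operator on a Hilbert space $H$ having compact resolvent and such that $-A$ generates an analytic semigroup. Assume that $H=\oplus_{k\in\mathbb{N}}H_k$, where the $H_k$ are finite-dimensional vector spaces such that for all $k\in\mathbb{N}$, $A^*(H_k)\subset H_k$ and $A^*|_{H_k}=A_k^*$, where $A_k^*$ is of the form $\lambda_kI+N_k$ with $\lambda_k\in\mathbb{C}$ and $N_k$ nilpotent. Assume that $\Re(\lambda_0)\le\Re(\lambda_1)\le\cdots\le\Re(\lambda_k)\le\cdots\to\infty$. Denoting by $\mathbb{P}_k$ the projection on $H_k$ parallel to $\oplus_{j\ne k}H_j$, assume that there exists $t_0>0$ such that $$\forall t\ge t_0,\qquad e^{-tA^*}=\sum_ke^{-tA_k^*}\mathbb{P}_k,$$ the right-hand side being norm convergent. Let $U$ be a Hilbert space and $B\in\mathscr{L}(U,\mathscr{D}(A^* )')$, let $n\in\mathbb{N}$ with $n\ge2$, assume that $U$ is isomorphic to $U_1\times\cdots\times U_n$ for some Hilbert spaces $U_1,\dots,U_n$ through a linear isomorphism $\pi:U_1\times\cdots\times U_n\to U$, and let $B_i\in\mathscr{L}(U_i,\mathscr{D}(A^* )')$ be the operators such that $B\pi(u_1,\dots,u_n)=\sum_{i=1}^nB_iu_i$ for all $(u_1,\dots,u_n)$. Assume that the system $y'+Ay=Bu$ is null-controllable in arbitrary small times. Then for every $T>0$ and every $y_0\in H$ there exist $u_i\in L^2(0,T;U_i)$, $i\in\{1,\dots,n\}$, such that the solution $y$ of $$y'+Ay=\sum_{i=1}^nB_iu_i,\quad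 t\in(0,T),\qquad y(0)=y_0,$$ satisfies $y(T)=0$, and such that $$\prod_{i=1}^n\Big(\sum_{j\ne i}\|u_j(t)\|_{U_j}\Big)=0\quad\text{for a.e. }t\in(0,T)$$ (i.e. at almost every time at most one control is non-zero).
   Context: Each $H_k$ is the generalized eigenspace of $A^*$ associated with the eigenvalue $\lambda_k$ (the $\lambda_k$ being the distinct eigenvalues of $A^*$), and $\mathbb{P}_k$ is the corresponding (bounded) spectral projection. $\mathscr{D}(A^* )'$ is the dual of $\mathscr{D}(A^* )$ with respect to the pivot space $H$; the semigroup $(e^{-tA})_{t\ge0}$ extends to $\mathscr{D}(A^* )'$. Solutions of $y'+Ay=F$, $y(0)=y_0$, are mild solutions $y(t)=e^{-tA}y_0+\int_0^te^{-(t-s)A}F(s)\,ds$ in $\mathscr{D}(A^* )'$. The system $y'+Ay=Bu$ is called null-controllable in arbitrary small times if for every $T>0$ there is a constant $C_T$ such that for every $y_0\in H$ there exists $u\in L^2(0,T;U)$ with $\|u\|_{L^2(0,T;U)}\le C_T\|y_0\|_H$ such that the solution $y$ of $y'+Ay=Bu$ on $(0,T)$, $y(0)=y_0$, satisfies $y(T)=0$. *)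

(* Defs.v *)
From HB Require Import structures.
From mathcomp Require Import all_boot all_order all_algebra sesquilinear.
From mathcomp Require Import all_classical all_reals all_analysis.
From mathcomp Require Import complex.

Set Implicit Arguments.
Unset Strict Implicit.
Unset Printing Implicit Defensive.

Import Order.TTheory GRing.Theory Num.Theory numFieldNormedType.Exports.

Local Open Scope classical_set_scope.
Local Open Scope ring_scope.
Local Open Scope complex_scope.

(* Norms of complex normed modules take values in [R[i]]; [rnorm] is the same
   norm seen as an element of [R]. *)
Definition rnorm (R : realType) (V : normedModType R[i]) (x : V) : R :=
  complex.Re `|x|.

Lemma rnormE (R : realType) (V : normedModType R[i]) (x : V) :
  `|x| = (rnorm x)%:C.
Proof. by rewrite /rnorm RRe_real// normr_real. Qed.

Lemma rnorm_ge0 (R : realType) (V : normedModType R[i]) (x : V) : 0 <= rnorm x.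
Proof. by rewrite -lecR -rnormE normr_ge0. Qed.

(* The inner product is linear in its first argument and antilinear in the
   second one. *)
HB.mixin Record isHilbert (R : realType) V of CompleteNormedModule R[i] V := {
  inner : {dot V for (@Num.conj R[i])};
  inner_norm : forall x : V, inner x x = `|x| ^+ 2
}.

#[short(type="hilbertType")]
HB.structure Definition Hilbert (R : realType) :=
  {V of CompleteNormedModule R[i] V & isHilbert R V}.

Definition bounded_op (R : realType) (V W : normedModType R[i]) (f : V -> W) :=
  linear f /\ continuous f.

Section Antidual.
Variables (R : realType) (V : normedModType R[i]).

(* Continuous antilinear functionals. *)
Definition bounded_antilinear (f : V -> R[i]) : Prop :=
  (forall a u v, f (a *: u + v) = Num.conj a * f u + f v) /\
  (exists M : R, forall u, `|f u| <= M%:C * `|u|).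

Definition bounded_antilinear_pred : {pred (V -> R[i])} :=
  fun f => `[< bounded_antilinear f >].

Fact bounded_antilinear_submod : submod_closed bounded_antilinear_pred.
Proof.
split.
  apply/asboolP; split=> [a u v|]; first by rewrite /= mulr0 addr0.
  by exists 0 => u; rewrite normr0 mul0r.
move=> c f g /asboolP[fl [M fM]] /asboolP[gl [N gN]]; apply/asboolP; split.
  move=> a u v; rewrite !fctE fl gl /GRing.scale/=.
  by rewrite !mulrDr mulrCA !addrA; congr (_ + _); rewrite addrAC.
exists (rnorm (c : R[i]^o) * M + N) => u; rewrite !fctE (le_trans (ler_normD _ _))//.
rewrite rmorphD/= mulrDl lerD// normrM rmorphM/= -mulrA -rnormE.
by rewrite ler_wpM2l.
Qed.

HB.instance Definition _ := GRing.isSubmodClosed.Build R[i] (V -> R[i])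
  bounded_antilinear_pred bounded_antilinear_submod.

Record antidual := Antidual {
  antidual_fun :> V -> R[i];
  antidual_prop : antidual_fun \in bounded_antilinear_pred
}.

HB.instance Definition _ := [isSub for antidual_fun].
HB.instance Definition _ := [Choice of antidual by <:].
HB.instance Definition _ := [SubChoice_isSubLmodule of antidual by <:].

Definition antidual_norm (f : antidual) : R[i] :=
  (sup [set complex.Re `|f u| | u in [set u : V | `|u| <= 1]])%:C.


Let values (f : antidual) : set R :=
  [set complex.Re `|f u| | u in [set u : V | `|u| <= 1]].

Let norm_re (z : R[i]) : `|z| = (complex.Re `|z|)%:C.
Proof. by rewrite RRe_real// normr_real. Qed.

Lemma antidualP (f : antidual) : bounded_antilinear f.
Proof. by case: f => f fP; exact/asboolP. Qed.

Lemma antidual0 (f : antidual) : f 0 = 0.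
Proof.
have [fl _] := antidualP f.
have := fl (-1) 0 0; rewrite scaler0 addr0 rmorphN rmorph1 mulN1r addNr. by [].
Qed.

Lemma antidualZ (f : antidual) a u : f (a *: u) = Num.conj a * f u.
Proof.
by have [fl _] := antidualP f; have := fl a u 0; rewrite antidual0 !addr0.
Qed.

Let values_sup (f : antidual) : has_sup (values f).
Proof.
have [_ [M fM]] := antidualP f; split.
  by exists (complex.Re `|f 0|), 0 => //=; rewrite normr0 ler01.
exists `|M| => _ [u /= u1 <-]; rewrite -lecR -norm_re (le_trans (fM u))//.
rewrite (@le_trans _ _ (`|M|%:C * `|u|))// ?ler_wpM2r ?lecR ?ler_norm//.
by rewrite ler_piMr// lecR.
Qed.

Lemma antidual_norm_ge0 (f : antidual) : 0 <= antidual_norm f.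
Proof.
rewrite lecR; apply: (@le_trans _ _ (complex.Re `|f 0|)).
  by rewrite -lecR -norm_re; exact: normr_ge0.
by apply: ub_le_sup; [exact: (values_sup f).2|exists 0 => //=; rewrite normr0 ler01].
Qed.

Lemma antidual_normP (f : antidual) u : `|f u| <= antidual_norm f * `|u|.
Proof.
have [->|u0] := eqVneq u 0; first by rewrite antidual0 !normr0 mulr0.
rewrite -ler_pdivrMr ?normr_gt0// mulrC.
have -> : `|u|^-1 * `|f u| = `|f (`|u|^-1 *: u)|.
  by rewrite antidualZ normrM norm_conjC normfV normr_id.
rewrite norm_re lecR; apply: ub_le_sup; first exact: (values_sup f).2.
exists (`|u|^-1 *: u) => //=.
by rewrite normrZ ger0_norm ?invr_ge0// mulVf ?normr_eq0.
Qed.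

Lemma antidual_norm_le (f : antidual) (M : R) :
  0 <= M -> (forall u, `|f u| <= M%:C * `|u|) -> antidual_norm f <= M%:C.
Proof.
move=> M0 fM; rewrite lecR; apply: ge_sup; first exact: (values_sup f).1.
move=> _ [u /= u1 <-]; rewrite -lecR -norm_re (le_trans (fM u))//.
by rewrite ler_piMr// lecR.
Qed.

Let antidual_ler_normD (f g : antidual) :
  antidual_norm (f + g) <= antidual_norm f + antidual_norm g.
Proof.
rewrite -rmorphD/=; apply: antidual_norm_le => [|u].
  by rewrite -lecR rmorphD/=; apply: addr_ge0; exact: antidual_norm_ge0.
rewrite rmorphD/= mulrDl (le_trans (ler_normD _ _))//.
by rewrite lerD// antidual_normP.
Qed.

Let antidual_le_normrZ (a : R[i]) (f : antidual) :
  antidual_norm (a *: f) <= `|a| * antidual_norm f.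
Proof.
rewrite (norm_re a) -rmorphM/=; apply: antidual_norm_le => [|u].
  rewrite -lecR rmorphM/= -norm_re.
  by apply: mulr_ge0 => //; exact: antidual_norm_ge0.
rewrite rmorphM/= -norm_re -mulrA -[X in `|X|]/(a * f u) normrM.
by rewrite ler_wpM2l// antidual_normP.
Qed.

Let antidual_normrZ (a : R[i]) (f : antidual) :
  antidual_norm (a *: f) = `|a| * antidual_norm f.
Proof.
apply/eqP; rewrite eq_le antidual_le_normrZ/=.
have [->|a0] := eqVneq a 0; first by rewrite normr0 mul0r antidual_norm_ge0.
rewrite mulrC -ler_pdivlMr ?normr_gt0// mulrC -normfV.
by rewrite -{1}(scale1r f) -(mulVf a0) -scalerA antidual_le_normrZ.
Qed.

Let antidual_normr0_eq0 (f : antidual) : antidual_norm f = 0 -> f = 0.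
Proof.
move=> f0; apply/val_inj/funext => u /=.
by apply/eqP; rewrite -normr_le0 (le_trans (antidual_normP f u))// f0 mul0r.
Qed.

HB.instance Definition _ := Lmodule_isNormed.Build R[i] antidual
  antidual_ler_normD antidual_normrZ antidual_normr0_eq0.

End Antidual.

Section HilbertTheory.
Variables (R : realType) (H : hilbertType R).

Lemma inner_conj (x y : H) : inner x y = Num.conj (inner y x).
Proof. by rewrite (hermC (inner (s := H)) x y) expr0 mul1r. Qed.

Lemma norm_inner_le (x y : H) : `|inner x y| <= `|x| * `|y|.
Proof.
have [->|y0] := eqVneq y 0; first by rewrite linear0r !normr0 mulr0.
have ny0 : `|y| != 0 by rewrite normr_eq0.
pose w := x - (inner x y / `|y| ^+ 2) *: y.
have wy : inner w y = 0.
  by rewrite linearBl/= linearZl_LR/= inner_norm divfK ?subrr// expf_neq0.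
have : 0 <= inner w w by rewrite inner_norm exprn_ge0.
rewrite {2}/w linearBr/= linearZr_LR/= wy mulr0 subr0.
rewrite linearBl/= linearZl_LR/= inner_norm (inner_conj y x) mulrAC -normCK.
rewrite subr_ge0 ler_pdivrMr ?exprn_gt0 ?normr_gt0// -exprMn.
by rewrite ler_sqr ?nnegrE// mulr_ge0.
Qed.

End HilbertTheory.

(* A densely defined linear operator; the values of [op] outside [dom] are
   irrelevant. *)
Record ddop (R : realType) (H : hilbertType R) := DDOp {
  dom : set H;
  op :> H -> H;
  dom0 : dom 0;
  domP : forall a x y, dom x -> dom y -> dom (a *: x + y);
  opP : forall a x y, dom x -> dom y -> op (a *: x + y) = a *: op x + op y;
  dom_dense : dense dom
}.

Section Adjoint.
Variables (R : realType) (H : hilbertType R) (A : ddop H).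

Definition adjoint_rel (phi psi : H) :=
  forall x, dom A x -> inner (A x) phi = inner x psi.

Definition dom_adj : set H := [set phi | exists psi, adjoint_rel phi psi].

Definition adj (phi : H) : H := xget 0 [set psi | adjoint_rel phi psi].

Lemma adjoint_rel_uniq phi psi psi' :
  adjoint_rel phi psi -> adjoint_rel phi psi' -> psi = psi'.
Proof.
move=> h h'; apply/eqP; rewrite -subr_eq0 -normr_eq0; apply/negPn/negP => d0.
pose d := psi - psi'.
have dpos : 0 < `|d| by rewrite lt_def d0 normr_ge0.
have orth x : dom A x -> inner x d = 0 by move=> Dx; rewrite linearBr/= -h// -h'// subrr.
clearbody d => {d0 h h'}.
have [x [xd Dx]] : ball d `|d| `&` dom A !=set0.
  apply: (dom_dense A); first by exists d; exact: ballxx.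
  exact: ball_open.
have : `|d| <= `|d - x|.
  rewrite -(ler_pM2r dpos) (le_trans _ (norm_inner_le _ _))//.
  suff <- : inner d d = inner (d - x) d by rewrite inner_norm normrX normr_id.
  by rewrite linearBl/= (orth x Dx) subr0.
by move: xd; rewrite -ball_normE/= => /lt_geF ->.
Qed.


Lemma adjP phi : dom_adj phi -> adjoint_rel phi (adj phi).
Proof. by move=> [psi h]; exact: (xgetPex 0 (ex_intro _ psi h)). Qed.

Lemma adjE phi psi : adjoint_rel phi psi -> adj phi = psi.
Proof.
by move=> h; apply: (@adjoint_rel_uniq phi) => //; apply: adjP; exists psi.
Qed.

Lemma adjoint_rel_lin a phi psi phi' psi' :
  adjoint_rel phi psi -> adjoint_rel phi' psi' ->
  adjoint_rel (a *: phi + phi') (a *: psi + psi').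
Proof.
move=> h h' x Dx.
by rewrite !linearDr/= !linearZr_LR/= h// h'.
Qed.

Definition dom_adj_pred : {pred H} := fun phi => `[< dom_adj phi >].

Fact dom_adj_submod : submod_closed dom_adj_pred.
Proof.
split; first by apply/asboolP; exists 0 => x _; rewrite !linear0r.
move=> a phi phi' /asboolP[psi h] /asboolP[psi' h']; apply/asboolP.
by exists (a *: psi + psi'); exact: adjoint_rel_lin.
Qed.

HB.instance Definition _ := GRing.isSubmodClosed.Build R[i] H
  dom_adj_pred dom_adj_submod.

(* The normed space D(A^* ), with the graph norm. *)
Record domain_adj := DomainAdj {
  domain_adj_val :> H;
  domain_adj_prop : domain_adj_val \in dom_adj_pred
}.

HB.instance Definition _ := [isSub for domain_adj_val].
HB.instance Definition _ := [Choice of domain_adj by <:].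
HB.instance Definition _ := [SubChoice_isSubLmodule of domain_adj by <:].

Definition graph_norm (phi : domain_adj) : R[i] := `|phi : H| + `|adj phi|.

Let domain_adjP (phi : domain_adj) : adjoint_rel phi (adj phi).
Proof. by apply: adjP; case: phi => phi /= /asboolP. Qed.

Let adj_lin a (phi phi' : domain_adj) :
  adj (a *: phi + phi' : domain_adj) = a *: adj phi + adj phi'.
Proof. by apply: adjE; exact: adjoint_rel_lin. Qed.

Let graph_ler_normD (phi phi' : domain_adj) :
  graph_norm (phi + phi') <= graph_norm phi + graph_norm phi'.
Proof.
rewrite /graph_norm -{2}[phi]scale1r adj_lin scale1r addrACA.
by rewrite lerD// ler_normD.
Qed.

Let graph_normrZ a (phi : domain_adj) :
  graph_norm (a *: phi) = `|a| * graph_norm phi.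
Proof.
have adj0 : adj (0 : domain_adj) = 0.
  by apply: adjE => x _; rewrite !linear0r.
rewrite /graph_norm -{2}[a *: phi]addr0 adj_lin adj0 addr0.
by rewrite /= !normrZ mulrDr.
Qed.

Let graph_normr0_eq0 (phi : domain_adj) : graph_norm phi = 0 -> phi = 0.
Proof.
move=> /eqP; rewrite paddr_eq0// normr_eq0 => /andP[/eqP phi0 _].
exact: val_inj.
Qed.

HB.instance Definition _ := Lmodule_isNormed.Build R[i] domain_adj
  graph_ler_normD graph_normrZ graph_normr0_eq0.

(* D(A^* )', the dual space for which the embedding of the pivot space H is
   linear: its elements are the continuous antilinear functionals. *)
Definition dual_dom_adj := antidual domain_adj.

HB.instance Definition _ := NormedModule.on dual_dom_adj.

Fact pivot_subproof (h : H) :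
  (fun phi : domain_adj => inner h (phi : H)) \in
  @bounded_antilinear_pred R domain_adj.
Proof.
apply/asboolP; split=> [a u v|].
  by rewrite /= linearDr/= linearZr_LR.
exists (rnorm h) => phi; rewrite -rnormE (le_trans (norm_inner_le _ _))//.
by rewrite ler_wpM2l// lerDl.
Qed.

Definition pivot (h : H) : dual_dom_adj := Antidual (pivot_subproof h).

End Adjoint.

Section Operators.
Variables (R : realType) (H : hilbertType R).
Implicit Types (D E F : set H) (L : H -> H).

Definition resolvent_at (A : ddop H) (mu : R[i]) (Q : H -> H) :=
  [/\ bounded_op Q,
      forall y, dom A (Q y) /\ mu *: Q y - A (Q y) = y
    & forall x, dom A x -> Q (mu *: x - A x) = x].

Definition compact_op (Q : H -> H) :=
  bounded_op Q /\ compact (closure (Q @` [set x : H | `|x| <= 1])).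

Definition compact_resolvent (A : ddop H) :=
  exists mu Q, resolvent_at A mu Q /\ compact_op Q.

Definition C0_semigroup (S : R -> H -> H) :=
  [/\ forall t, 0 <= t -> bounded_op (S t),
      forall x, S 0 x = x,
      forall s t, 0 <= s -> 0 <= t -> forall x, S (s + t) x = S s (S t x)
    & forall x, S t x @[t --> 0^'+] --> x].

(* [S] is a C0-semigroup whose generator is the operator [L] with domain
   [D]. *)
Definition generates D L (S : R -> H -> H) :=
  C0_semigroup S /\
  forall x y, (D x /\ L x = y) <->
    ((t^-1)%:C *: (S t x - x) @[t --> 0^'+] --> y).

(* The open sector of half-angle [theta] around the positive half-line, for
   [0 < theta < pi / 2]. *)
Definition sector (theta : R) : set R[i] :=
  [set z | 0 < complex.Re z /\ `|complex.Im z| < tan theta * complex.Re z].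

(* Complex differentiability at [z] for the operator norm. *)
Definition op_derivable (S : R[i] -> H -> H) (z : R[i]) :=
  exists S' : H -> H, bounded_op S' /\
    forall e : R, 0 < e -> \forall h \near (0 : R[i]^o)^', forall x,
      `|h^-1 *: (S (z + h) x - S z x) - S' x| <= e%:C * `|x|.

Definition generates_analytic D L (S : R -> H -> H) :=
  generates D L S /\
  exists (theta : R) (Sc : R[i] -> H -> H),
    0 < theta < pi / 2 /\
    [/\ forall t, 0 <= t -> Sc t%:C = S t,
        forall z, sector theta z -> bounded_op (Sc z),
        forall z w, sector theta z -> sector theta w ->
          forall x, Sc (z + w) x = Sc z (Sc w x),
        forall z, sector theta z -> op_derivable Sc z
      & forall x, Sc z x @[z --> within (sector theta) (nbhs (0 : R[i]^o))]
          --> x].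

Definition is_eigenvalue D L (mu : R[i]) :=
  exists x, [/\ x != 0, D x & L x = mu *: x].

(* [x] is in the domain of [(L - mu)^m] and [(L - mu)^m x = 0]. *)
Fixpoint iterated_kernel D L (mu : R[i]) (m : nat) (x : H) : Prop :=
  if m is m'.+1 then D x /\ iterated_kernel D L mu m' (L x - mu *: x)
  else x = 0.

Definition generalized_eigenspace D L (mu : R[i]) : set H :=
  [set x | exists m, iterated_kernel D L mu m x].

Definition linear_span E : set H :=
  [set x | exists (d : nat) (c : 'I_d -> R[i]) (e : 'I_d -> H),
    (forall i, E (e i)) /\ x = \sum_i c i *: e i].

Definition finite_dimensional E :=
  exists2 X : set H, finite_set X & E = linear_span X.

(* The topological sum of the [Hk j] for [j] in [J]. *)
Definition oplus (Hk : nat -> set H) (J : set nat) : set H :=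
  closure (linear_span (\bigcup_(j in J) Hk j)).

Definition direct_sum_decomposition (Hk : nat -> set H) :=
  oplus Hk setT = setT /\
  forall k, Hk k `&` oplus Hk [set j | j != k] = [set 0].

(* When [E] and [F] are linear subspaces with trivial intersection, there is
   at most one such [P]. *)
Definition projection_along E F (P : H -> H) :=
  bounded_op P /\ forall x, E (P x) /\ F (x - P x).

Definition nilpotent_on E (N : H -> H) :=
  [/\ forall x, E x -> E (N x),
      forall a x y, E x -> E y -> N (a *: x + y) = a *: N x + N y
    & exists m, forall x, E x -> iter m N x = 0].

(* The sum of the exponential series of [t L] applied to [x]. *)
Definition exp_op L (t : R) (x : H) : H :=
  limn (series (fun m => (t ^+ m / m`!%:R)%:C *: iter m L x)).

(* Convergence of the sequence [T_ n] to [T] for the operator norm. *)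
Definition norm_cvg (T_ : nat -> H -> H) (T : H -> H) :=
  forall e : R, 0 < e -> \forall n \near \oo,
    forall x, `|T_ n x - T x| <= e%:C * `|x|.

End Operators.

Section BochnerIntegral.
Variables (R : realType) (V : normedModType R[i]).
Local Notation mu := (@lebesgue_measure R).

Definition simple_function (s : R -> V) :=
  finite_set (range s) /\ forall v, measurable (s @^-1` [set v]).

(* Only used for sets [D] of finite measure. *)
Definition simple_integral (D : set R) (s : R -> V) : V :=
  \sum_(v \in range s) (fine (mu (D `&` s @^-1` [set v])))%:C *: v.

Definition strongly_measurable (D : set R) (f : R -> V) :=
  exists s_ : nat -> R -> V, (forall n, simple_function (s_ n)) /\
    forall t, D t -> s_ n t @[n --> \oo] --> f t.

(* [f] is Bochner integrable over [D], a set of finite measure, with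
   integral [v]. *)
Definition bochner_integral (D : set R) (f : R -> V) (v : V) :=
  strongly_measurable D f /\
  exists s_ : nat -> R -> V, [/\ forall n, simple_function (s_ n),
    (\int[mu]_(t in D) (rnorm (f t - s_ n t))%:E)%E @[n --> \oo] --> 0%E
  & simple_integral D (s_ n) @[n --> \oo] --> v].

Definition L2norm (T : R) (u : R -> V) : \bar R :=
  Lnorm mu 2%:E ((fun t => (rnorm (u t))%:E) \_ `]0, T[).

Definition L2fun (T : R) (u : R -> V) :=
  strongly_measurable `]0, T[ u /\ (L2norm T u < +oo)%E.

End BochnerIntegral.

Section ControlSystem.
Variables (R : realType) (H : hilbertType R) (A : ddop H).

(* [Sext] is the extension by continuity to D(A^* )' of the semigroup [S]
   on H; it is unique since H is dense in D(A^* )'. *)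
Definition extends_semigroup (S : R -> H -> H)
    (Sext : R -> dual_dom_adj A -> dual_dom_adj A) :=
  forall t, 0 <= t -> bounded_op (Sext t) /\
    forall h, Sext t (pivot A h) = pivot A (S t h).

(* [y] is the mild solution of [y' + A y = F] on [(0, T)], [y 0 = y0]. *)
Definition mild_solution (Sext : R -> dual_dom_adj A -> dual_dom_adj A)
    (T : R) (y0 : H) (F y : R -> dual_dom_adj A) :=
  forall t, 0 <= t <= T ->
    exists2 v, bochner_integral `]0, t[ (fun s => Sext (t - s) (F s)) v
    & y t = Sext t (pivot A y0) + v.

Definition null_controllable_small_times (U : hilbertType R)
    (Sext : R -> dual_dom_adj A -> dual_dom_adj A) (B : U -> dual_dom_adj A) :=
  forall T : R, 0 < T -> exists C : R, forall y0 : H, exists u : R -> U,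
    [/\ L2fun T u,
        (L2norm T u <= (C * rnorm y0)%:E)%E
      & exists2 y, mild_solution Sext T y0 (fun t => B (u t)) y & y T = 0].

End ControlSystem.

(* A linear isomorphism (bicontinuous) from the product of the [U i] onto
   [V]. *)
Definition product_isomorphism (R : realType) (n : nat)
    (U : 'I_n -> normedModType R[i]) (V : normedModType R[i])
    (p : (forall i, U i) -> V) :=
  [/\ forall a u v, p (fun i => a *: u i + v i) = a *: p u + p v,
      bijective p
    & exists c C : R, 0 < c /\ forall u,
        c%:C * (\sum_i `|u i|) <= `|p u| <= C%:C * (\sum_i `|u i|)].

(* Main.v *)
Require Import Defs.
From HB Require Import structures.
From mathcomp Require Import all_boot all_order all_algebra sesquilinear.
From mathcomp Require Import all_classical all_reals all_analysis.
From mathcomp Require Import complex.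
From mathcomp Require Import measurable_realfun.
From mathcomp Require Import ring lra.

Set Implicit Arguments.
Unset Strict Implicit.
Unset Printing Implicit Defensive.

Import Order.TTheory GRing.Theory Num.Theory numFieldNormedType.Exports.

Local Open Scope classical_set_scope.
Local Open Scope ring_scope.
Local Open Scope complex_scope.

(* Let [mu] be in the resolvent set of [A] and [Q] the resolvent.  Then
   [h |-> (phi |-> <h, (conj mu - A^* ) phi>)] is an isomorphism of [H] onto
   D(A^* )' which carries [Q h] to the pivot image of [h], conjugates the
   extended semigroup to [S], and turns the [B_ i] into bounded operators into
   [H].

   Take a null control [u] on the first half of a time interval.  Split the
   interval into measurable sets [E_i] on which simple approximations of the
   integrands are equidistributed, and use on [E_i] only the [i]-th component,
   multiplied by the number of components.  This switching control costs at most
   that number times the norm of [u], and it misses the target by an arbitrarily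
   small error.  During the second half no control acts, and analyticity turns
   the error in D(A^* )' into an arbitrarily small state of [H].  Repeat this on
   intervals that shrink geometrically to [T].  The error of each step can be
   chosen after the cost constant of the next, so the total cost is finite
   however fast these constants grow, and the state tends to [0] at [T]. *)

(** * Real-valued norms and bounded operators *)

(** A chattering control follows a given control only weakly, so the state it reaches agrees with
    the target up to an error that can be made small but not zero; hence infinitely many steps. This
    error is measured in D(A^* )', where the [B_ i] take their values, whereas the cost of the next
    step is measured by the norm of the state in [H]: the free half of each interval bridges this
    gap.

    In the copy of [H], a state [y] is represented by [Q y]. A defect [d] left at half time thus
    becomes, after a free evolution of length [t], the state [(mu - A) (S t d)], which makes sense
    because [S t] maps into the domain of [A].

    Working in a Hilbert space also allows integrals to be handled weakly: identities between vector
    integrals are tested against vectors and become identities between real Lebesgue integrals.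
    Bochner integrals remain for existence, for approximation by simple functions, and for
    translating the hypothesis and the conclusion. *)

Section RealNorm.
Variables (R : realType) (V : normedModType R[i]).
Implicit Types (x y : V) (a : R).

Lemma rnorm_le_C x a : (rnorm x <= a) = (`|x| <= a%:C).
Proof. by rewrite rnormE lecR. Qed.

Lemma rnormD x y : rnorm (x + y) <= rnorm x + rnorm y.
Proof. by rewrite -lecR rmorphD/= -!rnormE ler_normD. Qed.

Lemma rnormZ (c : R[i]) x : rnorm (c *: x) = complex.Re `|c| * rnorm x.
Proof.
apply: (@complexI R); rewrite rmorphM -!rnormE normrZ; congr (_ * _).
by rewrite [RHS]RRe_real// normr_real.
Qed.

Lemma rnormZr a x : rnorm (a%:C *: x) = `|a| * rnorm x.
Proof. by rewrite rnormZ normc_def/= expr0n addr0 sqrtr_sqr. Qed.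

Lemma rnormN x : rnorm (- x) = rnorm x.
Proof. by rewrite /rnorm normrN. Qed.

Lemma rnormB x y : rnorm (x - y) <= rnorm x + rnorm y.
Proof. by rewrite -(rnormN y) rnormD. Qed.

Lemma rnormC x y : rnorm (x - y) = rnorm (y - x).
Proof. by rewrite -rnormN opprB. Qed.

Lemma rnorm0 : rnorm (0 : V) = 0.
Proof. by rewrite /rnorm normr0. Qed.

Lemma rnorm_eq0 x : (rnorm x == 0) = (x == 0).
Proof. by rewrite -[RHS]normr_eq0 rnormE -[0%R in RHS]/(0%:C) (inj_eq (@complexI R)). Qed.

Lemma rnorm_dist x y : `|rnorm x - rnorm y| <= rnorm (x - y).
Proof.
rewrite ler_norml; apply/andP; split.
  rewrite lerBrDr addrC lerBlDr rnormC addrC.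
  by apply: le_trans (rnormD _ _); rewrite subrK.
by rewrite lerBlDr; apply: le_trans (rnormD _ _); rewrite subrK.
Qed.

Lemma rnorm_sum (I : Type) (r : seq I) (P : pred I) (F : I -> V) :
  rnorm (\sum_(i <- r | P i) F i) <= \sum_(i <- r | P i) rnorm (F i).
Proof.
elim/big_ind2 : _ => [|x a y b xa yb|//]; first by rewrite rnorm0.
by rewrite (le_trans (rnormD _ _))// lerD.
Qed.

(** A positive element of [R[i]] is real, so the complex radii of the topology can be replaced with
    real ones. *)
Lemma rcvgP (T : Type) (F : set_system T) {FF : Filter F} (f : T -> V) l :
  f @ F --> l <-> forall e, 0 < e -> \forall t \near F, rnorm (f t - l) < e.
Proof.
split=> [/cvgrPdist_lt h e e0|h].
  have := h e%:C; rewrite ltcR => /(_ e0); apply: filterS => t.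
  by rewrite rnormC -ltcR -rnormE.
apply/cvgrPdist_lt => e e0.
have er : e = (complex.Re e)%:C by rewrite RRe_real// gtr0_real.
have /h : 0 < complex.Re e by rewrite -ltcR -er.
by apply: filterS => t; rewrite rnormC -ltcR -rnormE -er.
Qed.

Lemma rcvg0P (T : Type) (F : set_system T) {FF : Filter F} (f : T -> V) l :
  f @ F --> l <-> rnorm (f t - l) @[t --> F] --> (0 : R).
Proof.
rewrite rcvgP; split=> [h|/cvgr0Pnorm_lt h].
  apply/cvgr0Pnorm_lt => e e0; apply: filterS (h e e0) => t.
  by rewrite ger0_norm ?rnorm_ge0.
by move=> e /h; apply: filterS => t; rewrite ger0_norm ?rnorm_ge0.
Qed.

Lemma rnorm_cvg (T : Type) (F : set_system T) {FF : Filter F} (f : T -> V) l :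
  f @ F --> l -> rnorm (f t) @[t --> F] --> rnorm l.
Proof.
move=> /rcvgP h; apply/cvgrPdist_lt => e /h; apply: filterS => t.
by rewrite distrC; apply: le_lt_trans (rnorm_dist _ _).
Qed.

End RealNorm.

Lemma rcauchy_cvg (R : realType) (V : completeNormedModType R[i])
    (x_ : nat -> V) :
  (forall e : R, 0 < e -> exists N, forall m n, (N <= m)%N -> (N <= n)%N ->
     rnorm (x_ m - x_ n) < e) ->
  exists l : V, x_ n @[n --> \oo] --> l.
Proof.
move=> h; suff : cauchy (x_ n @[n --> \oo]) by move=> /cauchy_cvg/cvg_ex.
apply/cauchy_ballP => e e0.
have er : e = (complex.Re e)%:C by rewrite RRe_real// gtr0_real.
have [|N hN] := h (complex.Re e); first by rewrite -ltcR -er.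
exists ([set y | exists2 m, (N <= m)%N & y = x_ m],
        [set y | exists2 m, (N <= m)%N & y = x_ m]) => /=.
  by split; exists N => // m /= Nm; exists m.
move=> [y z] /= [[m Nm ->] [k Nk ->]].
by rewrite -ball_normE/= rnormE er ltcR; exact: hN.
Qed.

Section BoundedOp.
Variables (R : realType) (V W : normedModType R[i]).
Implicit Types (f : V -> W).

Lemma op_lin_zero f : linear f -> f 0 = 0.
Proof. by move=> fl; have := fl (-1) 0 0; rewrite scaler0 addr0 scaleN1r addNr. Qed.

Lemma op_linD f x y : linear f -> f (x + y) = f x + f y.
Proof. by move=> fl; have := fl 1 x y; rewrite !scale1r. Qed.

Lemma op_linZ f a x : linear f -> f (a *: x) = a *: f x.
Proof. by move=> fl; have := fl a x 0; rewrite (op_lin_zero fl) !addr0. Qed.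

Lemma op_linN f x : linear f -> f (- x) = - f x.
Proof. by move=> fl; rewrite -scaleN1r op_linZ// scaleN1r. Qed.

Lemma op_linB f x y : linear f -> f (x - y) = f x - f y.
Proof. by move=> fl; rewrite op_linD// op_linN. Qed.

Lemma op_lin_sum f (I : Type) (r : seq I) (P : pred I) (F : I -> V) :
  linear f -> f (\sum_(i <- r | P i) F i) = \sum_(i <- r | P i) f (F i).
Proof.
move=> fl; apply: (big_morph f) => [x y|]; first exact: op_linD.
exact: op_lin_zero.
Qed.

Definition norm_bounded f := exists2 M : R, 0 <= M & forall x, rnorm (f x) <= M * rnorm x.

(** Continuity at 0 bounds [f] by 1 on some ball of radius [d]; every non-zero vector is rescaled to
    norm [d / 2], whence the constant [2 / d]. *)
Lemma bounded_op_norm f : bounded_op f -> norm_bounded f.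
Proof.
move=> [fl /(_ 0) fc].
have : f x @[x --> nbhs 0] --> f 0 by [].
move=> /cvgrPdist_lt/(_ 1 ltr01)/nbhs_ballP[e/= e0 he].
have er : e = (complex.Re e)%:C by rewrite RRe_real// gtr0_real.
set d := complex.Re e in er; have d0 : 0 < d by rewrite -ltcR -er.
exists (2 / d) => [|x]; first by rewrite divr_ge0// ltW.
have [->|x0] := eqVneq x 0.
  by rewrite op_lin_zero// !rnorm0 mulr0.
have nx0 : 0 < rnorm x by rewrite lt_def rnorm_eq0 x0 rnorm_ge0.
pose c := d / (2 * rnorm x).
have c0 : 0 < c by rewrite divr_gt0// mulr_gt0.
have : ball 0 e (c%:C *: x).
  rewrite -ball_normE/= sub0r rnormE rnormN er ltcR rnormZr gtr0_norm//.
  rewrite /c invfM -!mulrA mulVf ?gt_eqF// mulr1.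
  by rewrite gtr_pMr// invf_lt1// ltr1n.
move=> /he; rewrite op_lin_zero// sub0r rnormE rnormN op_linZ//.
rewrite -[1]/(1%:C) ltcR rnormZr gtr0_norm// => /ltW.
rewrite -ler_pdivlMl// mulr1 => /le_trans; apply.
by rewrite /c invf_div mulrAC.
Qed.

Lemma norm_bounded_op f : linear f -> norm_bounded f -> bounded_op f.
Proof.
move=> fl [M M0 fM]; split=> // x; apply/rcvg0P.
apply: (@squeeze_cvgr _ _ _ _ (cst 0) (fun t => M * rnorm (t - x))).
- by apply: nearW => y; rewrite rnorm_ge0/= -op_linB.
- exact: cvg_cst.
- rewrite -(mulr0 M); apply: cvgM; first exact: cvg_cst.
  by apply/rcvg0P; exact: cvg_id.
Qed.

End BoundedOp.

Lemma bounded_op_comp (R : realType) (V W X : normedModType R[i])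
    (f : V -> W) (g : W -> X) :
  bounded_op f -> bounded_op g -> bounded_op (g \o f).
Proof.
move=> [fl fc] [gl gc]; split=> [a x y|]; first by rewrite /= fl gl.
by move=> x; apply: continuous_comp; [exact: fc|exact: gc].
Qed.

(** * Real inner product, Riesz representation, uniform boundedness *)

Section RealInner.
Variables (R : realType) (H : hilbertType R).
Implicit Types (x y z : H) (a : R).

(** Real values give access to real Lebesgue integration; by [rinner_inj], testing through real
    parts loses no information. *)
Definition rinner x y : R := complex.Re (inner x y).

Lemma rinnerC x y : rinner x y = rinner y x.
Proof. by rewrite /rinner inner_conj; case: (inner y x). Qed.

Lemma rinnerDl x y z : rinner (x + y) z = rinner x z + rinner y z.
Proof. by rewrite /rinner linearDl/= raddfD. Qed.

Lemma rinnerNl x z : rinner (- x) z = - rinner x z.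
Proof. by rewrite /rinner linearNl/= raddfN. Qed.

Lemma rinnerBl x y z : rinner (x - y) z = rinner x z - rinner y z.
Proof. by rewrite rinnerDl rinnerNl. Qed.

Lemma rinnerZl a x z : rinner (a%:C *: x) z = a * rinner x z.
Proof.
by rewrite /rinner linearZl_LR/=; case: (inner x z) => u v/=; rewrite mul0r subr0.
Qed.

Lemma rinner0l z : rinner 0 z = 0.
Proof. by rewrite /rinner linear0l. Qed.

Lemma rinnerDr x y z : rinner z (x + y) = rinner z x + rinner z y.
Proof. by rewrite !(rinnerC z) rinnerDl. Qed.

Lemma rinnerBr x y z : rinner z (x - y) = rinner z x - rinner z y.
Proof. by rewrite !(rinnerC z) rinnerBl. Qed.

Lemma rinnerZr a x z : rinner z (a%:C *: x) = a * rinner z x.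
Proof. by rewrite !(rinnerC z) rinnerZl. Qed.

Lemma rinner_suml (I : Type) (r : seq I) (P : pred I) (F : I -> H) z :
  rinner (\sum_(i <- r | P i) F i) z = \sum_(i <- r | P i) rinner (F i) z.
Proof.
apply: (big_morph (rinner^~ z)) => [x y|]; [exact: rinnerDl|exact: rinner0l].
Qed.

Lemma rinner_norm x : rinner x x = rnorm x ^+ 2.
Proof. by rewrite /rinner inner_norm rnormE -rmorphXn. Qed.

Lemma rinner_le x y : `|rinner x y| <= rnorm x * rnorm y.
Proof.
rewrite -lecR rmorphM/= -!rnormE; apply: le_trans (norm_inner_le x y).
exact: normc_ge_Re.
Qed.

Lemma rinner_inj x y : (forall z, rinner x z = rinner y z) -> x = y.
Proof.
move=> h; apply/eqP; rewrite -subr_eq0 -rnorm_eq0 -sqrf_eq0 -rinner_norm.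
by rewrite rinnerBl h subrr.
Qed.

Lemma rinner_cvg (T : Type) (F : set_system T) {FF : Filter F} (f : T -> H) l z :
  f @ F --> l -> rinner (f t) z @[t --> F] --> rinner l z.
Proof.
move=> /rcvg0P fl; apply/subr_cvg0/cvgr0Pnorm_le => e e0.
have z0 : 0 < rnorm z + 1 by rewrite ltr_wpDl ?rnorm_ge0.
move/cvgr0Pnorm_lt : fl => /(_ (e / (rnorm z + 1)) (divr_gt0 e0 z0)).
apply: filterS => t; rewrite ger0_norm ?rnorm_ge0// ltr_pdivlMr// => h.
rewrite -rinnerBl (le_trans (rinner_le _ _))// ltW// (le_lt_trans _ h)//.
by rewrite ler_wpM2l ?rnorm_ge0// lerDl.
Qed.

Lemma rnorm_parallelogram x y :
  rnorm (x - y) ^+ 2 = 2 * rnorm x ^+ 2 + 2 * rnorm y ^+ 2 - rnorm (x + y) ^+ 2.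
Proof.
rewrite -!rinner_norm !(rinnerBl, rinnerDl, rinnerBr, rinnerDr) (rinnerC y x).
by ring.
Qed.

End RealInner.

Section Riesz.
Variables (R : realType) (H : hilbertType R).

(* [h] is the limit of a minimizing sequence of [|x|^2 - 2 Re (g x)], which is
   a Cauchy sequence by the parallelogram identity. *)
Lemma riesz (g : H -> R[i]) :
  bounded_antilinear g -> exists h, forall x, g x = inner h x.
Proof.
move=> [gl [M gM]].
pose r x := complex.Re (g x).
have rM x : `|r x| <= `|M| * rnorm x.
  rewrite -lecR rmorphM/= -rnormE.
  have : `|g x| <= `|M|%:C * `|x|.
    by rewrite (le_trans (gM x))// ler_wpM2r// lecR ler_norm.
  apply: le_trans; exact: normc_ge_Re.
have rlin a x y : r (a%:C *: x + y) = a * r x + r y.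
  rewrite /r gl raddfD/=; congr (_ + _).
  by case: (g x) => u v/=; rewrite oppr0 mul0r subr0.
have r0 : r 0 = 0.
  by have := rlin (-1) 0 0; rewrite scaler0 addr0 mulN1r addNr.
have rZ a x : r (a%:C *: x) = a * r x.
  by have := rlin a x 0; rewrite !addr0 r0 addr0.
have rD x y : r (x + y) = r x + r y.
  by have := rlin 1 x y; rewrite scale1r mul1r.
pose J x := rnorm x ^+ 2 - 2 * r x.
have Jlb : has_lbound (range J).
  exists (- `|M| ^+ 2) => _ [x _ <-]; rewrite /J.
  have /ler_normlP[_ rx] := rM x; have := sqr_ge0 (rnorm x - `|M|); nra.
pose m := inf (range J).
have mJ x : m <= J x by apply: ge_inf => //; exists x.
have /choice[x_ x_m] n : exists x, J x < m + (n.+1%:R)^-1.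
  have Jinf : has_inf (range J) by split => //; exists (J 0), 0.
  have n0 : 0 < (n.+1%:R : R)^-1 by rewrite invr_gt0.
  by have [_ [x _ <-] xm] := inf_adherent n0 Jinf; exists x.
(* The parallelogram identity, with [m <= J] at the midpoint of [x] and [y]. *)
have key x y : rnorm (x - y) ^+ 2 <= 2 * J x + 2 * J y - 4 * m.
  have := mJ ((2^-1)%:C *: (x + y)).
  rewrite rnorm_parallelogram /J rnormZr ger0_norm ?invr_ge0// rZ rD exprMn.
  have -> : (2^-1 : R) ^+ 2 = 4^-1 by rewrite exprVn; congr (_^-1); ring.
  lra.
have [h x_h] : exists h : H, x_ n @[n --> \oo] --> h.
  apply: rcauchy_cvg => e e0.
  have e2 : 0 < e ^+ 2 / 4 by rewrite divr_gt0// exprn_gt0.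
  have [N _ hN] := near_infty_natSinv_lt (PosNum e2).
  exists N => p q Np Nq; rewrite -(@ltr_pXn2r _ 2)// ?nnegrE ?rnorm_ge0 ?ltW//.
  rewrite (le_lt_trans (key _ _))//.
  have /= := hN p Np; have /= := hN q Nq; have := x_m p; have := x_m q. 
  move: (J (x_ q)) (J (x_ p)) (q.+1%:R^-1) (p.+1%:R^-1) (e ^+ 2) => *; lra.
have var y : r y = rinner h y.
  apply/eqP; rewrite eq_sym -subr_eq0; apply/negPn/negP => d0.
  set d := rinner h y - r y in d0.
  (* First variation: [J] at [x_ n + t y] is at least [m], while [J (x_ n)] exceeds [m] by less than
     [1 / (n + 1)]; then [n] tends to infinity. *)
  have h1 t : 0 <= 2 * t * d + t ^+ 2 * rnorm y ^+ 2.
    have cv : 2 * t * (rinner (x_ n) y - r y) + t ^+ 2 * rnorm y ^+ 2 +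
              (n.+1%:R)^-1 @[n --> \oo]
              --> 2 * t * d + t ^+ 2 * rnorm y ^+ 2 + 0.
      apply: cvgD; last exact: cvg_harmonic.
      apply: cvgD; last exact: cvg_cst.
      apply: cvgM; first exact: cvg_cst.
      apply: cvgB; last exact: cvg_cst.
      exact: rinner_cvg.
    rewrite -[leRHS]addr0; apply: (cvgr_to_ge cv); apply: nearW => n.
    have := mJ (x_ n + t%:C *: y); have := x_m n.
    rewrite /J rD rZ -!rinner_norm !(rinnerDl, rinnerDr, rinnerZl, rinnerZr).
    rewrite (rinnerC y); move: (n.+1%:R^-1 : R) => k. lra.
  (* At [t = - d / b] the quadratic of [h1] is negative unless [d = 0]; the added 1 covers
     [y = 0]. *)
  pose b := rnorm y ^+ 2 + 1.
  have b0 : 0 < b by rewrite ltr_wpDl ?sqr_ge0.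
  have := h1 (- d / b).
  have -> : 2 * (- d / b) * d + (- d / b) ^+ 2 * rnorm y ^+ 2 =
     - (d ^+ 2 / b ^+ 2) * (b + 1).
    by rewrite /b; field; rewrite gt_eqF.
  rewrite mulNr oppr_ge0 leNgt => /negP; apply.
  apply: mulr_gt0; last exact: addr_gt0.
  by apply: divr_gt0; [rewrite exprn_even_gt0|rewrite exprn_gt0].
exists h => x; apply/eqP; rewrite eq_complex; apply/andP; split.
  by have := var x; rewrite /r /rinner => ->.
have g0 : g 0 = 0.
  by have := gl (-1) 0 0; rewrite scaler0 addr0 rmorphN rmorph1 mulN1r addNr.
(* The identity of real parts at ['i *: x] gives that of imaginary parts at [x]. *)
have := var ('i *: x); rewrite /r /rinner.
have := gl 'i x 0; rewrite addr0 g0 addr0 => ->.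
rewrite linearZr_LR/=.
case: (g x) (inner h x) => [u v] [u' v'] /=.
by rewrite !mul0r !sub0r !mulN1r !opprK => ->.
Qed.

(** Riesz representation of the antilinear functional [x |-> inner y (f x)]; the bound on [g] comes
    from [|g y|^2 = <f (g y), y>]. *)
Lemma adjoint_exists (f : H -> H) : bounded_op f ->
  exists2 g : H -> H, bounded_op g & forall x y, inner (f x) y = inner x (g y).
Proof.
move=> fb; have [M M0 fM] := bounded_op_norm fb; have [fl _] := fb.
have /choice[g hg] y : exists z, forall x, inner y (f x) = inner z x.
  apply: riesz; split=> [a u v|].
    by rewrite fl linearDr/= linearZr_LR.
  exists (rnorm y * M) => u; apply: le_trans (norm_inner_le _ _) _.
  by rewrite !rnormE -!rmorphM lecR/= -mulrA ler_wpM2l ?rnorm_ge0.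
have hg' x y : inner (f x) y = inner x (g y).
  by rewrite inner_conj hg -inner_conj.
exists g => //; apply: norm_bounded_op.
  move=> a x y; apply: rinner_inj => z; rewrite /rinner; congr complex.Re.
  by rewrite -hg !linearDl/= !linearZl_LR/= !hg.
exists M => // y; have [->|gy0] := eqVneq (g y) 0.
  by rewrite rnorm0 mulr_ge0 ?rnorm_ge0.
rewrite -(@ler_pM2l _ (rnorm (g y))); last by rewrite lt_def rnorm_eq0 gy0 rnorm_ge0.
rewrite -expr2 -rinner_norm /rinner -hg' -/(rinner _ _).
apply: le_trans (ler_norm _) _; apply: le_trans (rinner_le _ _) _.
by rewrite mulrA ler_wpM2r ?rnorm_ge0// mulrC.
Qed.

End Riesz.

(* Gliding hump. *)
Lemma uniform_boundedness (R : realType) (V : completeNormedModType R[i])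
    (W : normedModType R[i]) (T_ : nat -> V -> W) :
  (forall n, linear (T_ n)) -> (forall n, norm_bounded (T_ n)) ->
  (forall x, exists K, forall n, rnorm (T_ n x) <= K) ->
  exists K, forall n x, rnorm (T_ n x) <= K * rnorm x.
Proof.
move=> Tl Tb Tp; apply: contrapT => /forallNP unb.
(* A pair is a centre and a radius. The new centre makes some [T_ n] at least [k]; the new radius is
   so small that this [T_ n] varies by at most 1 on the ball of twice that radius. *)
have step (k : nat) (s : V * R) : exists s' : V * R, 0 < s.2 ->
    [/\ rnorm (s'.1 - s.1) <= s.2, 0 < s'.2, 2 * s'.2 <= s.2 &
      exists n, k%:R <= rnorm (T_ n s'.1) /\
        forall y, rnorm y <= 2 * s'.2 -> rnorm (T_ n y) <= 1].
  case: s => x r /=; have [r0|r0] := ltP 0 r; last first.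
    by exists (0, 0).
  have /existsNP[n /existsNP[z /negP]] := unb (k%:R / r).
  rewrite -ltNge => hz.
  have nz0 : 0 < rnorm z.
    rewrite lt_def rnorm_eq0 rnorm_ge0 andbT; apply/eqP => z0.
    by move: hz; rewrite z0 (op_lin_zero (Tl n)) !rnorm0 mulr0 ltxx.
  pose w := (r / rnorm z)%:C *: z.
  have c0 : 0 < r / rnorm z by rewrite divr_gt0.
  have nw : rnorm w = r by rewrite /w rnormZr gtr0_norm// divfK// gt_eqF.
  have Tw : k%:R <= rnorm (T_ n w).
    rewrite /w (op_linZ _ _ (Tl n)) rnormZr gtr0_norm//.
    rewrite -(@ler_pM2l _ (rnorm z / r)) ?divr_gt0//.
    have -> : rnorm z / r * (r / rnorm z * rnorm (T_ n z)) = rnorm (T_ n z).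
      by field; rewrite !gt_eqF.
    by apply/ltW; move: hz; congr (_ < _); ring.
  have [M M0 TM] := Tb n.
  pose r' := Num.min (r / 2) ((2 * (M + 1))^-1).
  have M1 : 0 < 2 * (M + 1) by rewrite mulr_gt0// ltr_wpDl.
  have r'0 : 0 < r' by rewrite lt_min invr_gt0 M1 divr_gt0.
  have r'r : 2 * r' <= r.
    by rewrite mulrC -ler_pdivlMr// ge_min lexx.
  have small y : rnorm y <= 2 * r' -> rnorm (T_ n y) <= 1.
    move=> yr; rewrite (le_trans (TM y))//.
    apply: (@le_trans _ _ (M * (2 * (2 * (M + 1))^-1))).
      rewrite ler_wpM2l// (le_trans yr)// ler_pM2l//.
      by rewrite ge_min lexx orbT.
    by rewrite mulrA ler_pdivrMr// mul1r; lra.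
  (* [2 T_ n w] is the difference of the values at [x + w] and [x - w], so at one of these two
     points the norm is at least [k]. *)
  have [h|h] := leP k%:R (rnorm (T_ n (x + w))).
    exists (x + w, r') => _ /=; split=> //; last by exists n.
    by rewrite addrC addKr nw.
  exists (x - w, r') => _ /=; split=> //; last first.
    exists n; split=> //.
    have e : T_ n (x + w) - T_ n (x - w) = 2%:C *: T_ n w.
      rewrite -(op_linB _ _ (Tl n)) opprB addrC addrA subrK.
      by rewrite (op_linD _ _ (Tl n)) rmorph_nat scaler_nat mulr2n.
    have := rnormB (T_ n (x + w)) (T_ n (x - w)).
    by rewrite e rnormZr ger0_norm//; lra.
  by rewrite addrC addKr rnormN nw.
have /choice[F hF] : forall ks : nat * (V * R), exists s' : V * R, 0 < ks.2.2 ->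
    [/\ rnorm (s'.1 - ks.2.1) <= ks.2.2, 0 < s'.2, 2 * s'.2 <= ks.2.2 &
      exists n, ks.1%:R <= rnorm (T_ n s'.1) /\
        forall y, rnorm y <= 2 * s'.2 -> rnorm (T_ n y) <= 1].
  by move=> [k s]; exact: step.
pose s := fix s k := if k is k'.+1 then F (k', s k') else (0, 1).
have s0 k : 0 < (s k).2.
  by elim: k => [|k ih] //=; have [] := hF (k, s k) ih.
have sS k := hF (k, s k) (s0 k).
(* The radius at least halves, so each move, of length at most the old radius, is at most twice the
   decrease of the radius; this telescopes. *)
have dist k m : rnorm ((s (k + m)%N).1 - (s k).1) <= 2 * ((s k).2 - (s (k + m)%N).2).
  elim: m => [|m ih]; first by rewrite addn0 !subrr rnorm0 mulr0.
  rewrite addnS; have [/= h1 _ h2 _] := sS (k + m)%N.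
  rewrite -(subrKA (s (k + m)%N).1).
  by rewrite (le_trans (rnormD _ _))//=; lra.
have s2 k : (s k).2 <= (2^-1) ^+ k.
  elim: k => [|k ih] //; have [/= _ _ h2 _] := sS k; rewrite exprS.
  rewrite ler_pdivlMl//; exact: le_trans ih.
have [x xs] : exists x : V, (s n).1 @[n --> \oo] --> x.
  apply: rcauchy_cvg => e e0.
  have /cvgrPdist_lt/(_ (e / 4)) : (2^-1 : R) ^+ n @[n --> \oo] --> 0.
    by apply: cvg_expr; rewrite ger0_norm// invf_lt1// ltr1n.
  case; first by rewrite divr_gt0.
  move=> N _ /(_ N (leqnn N))/=; rewrite sub0r normrN ger0_norm ?exprn_ge0// => hN.
  exists N => p q Np Nq.
  have := dist N (p - N)%N; have := dist N (q - N)%N; rewrite !subnKC// => hp hq.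
  rewrite -(subrKA (s N).1).
  apply: (le_lt_trans (rnormD _ _)); rewrite (rnormC (s N).1).
  have := s2 N; have := s0 p; have := s0 q; lra.
have tail k : rnorm (x - (s k).1) <= 2 * (s k).2.
  have cv : (s n).1 - (s k).1 @[n --> \oo] --> x - (s k).1.
    by apply: cvgB => //; exact: cvg_cst.
  apply: (cvgr_to_le (rnorm_cvg cv)).
  exists k => // n /= kn; have := dist k (n - k)%N; rewrite subnKC//.
  have := s0 n; lra.
(* The limit [x] lies within twice the radius of every centre, so the operator chosen at stage [k]
   has norm at least [k - 1] at [x]; any [k > K + 1] gives a contradiction. *)
have [K hK] := Tp x.
have [k kK] : exists k : nat, K + 1 < k%:R.
  by exists (Num.truncn (K + 1)).+1; rewrite truncnS_gt.
have [/= _ _ _ [n [h1 h2]]] := sS k.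
have := h2 _ (tail k.+1); rewrite (op_linB _ _ (Tl n)) /= => h3.
have := rnormB (T_ n x) (T_ n x - T_ n (F (k, s k)).1).
rewrite opprB addrC subrK; have := hK n; lra.
Qed.

(** * Simple and strongly measurable functions *)

Section FiniteRange.
Variable R : realType.
Implicit Types (X Y : Type) (E D : set R).

(* Same as [simple_function], for an arbitrary codomain. *)
Definition fsimple X (q : R -> X) :=
  finite_set (range q) /\ forall v, measurable (q @^-1` [set v]).

Lemma fsimple_preimage X (q : R -> X) (Z : set X) :
  fsimple q -> measurable (q @^-1` Z).
Proof.
move=> [fq mq].
have -> : q @^-1` Z = \bigcup_(v in range q `&` Z) q @^-1` [set v].
  apply/seteqP; split=> [t Zt|t [v [_ Zv] /= tv]]; last by rewrite /= tv.
  by exists (q t) => //; split => //; exists t.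
apply: fin_bigcup_measurable => //; exact: finite_setIl.
Qed.

Lemma fsimple_comp X Y (f : X -> Y) (q : R -> X) : fsimple q -> fsimple (f \o q).
Proof.
move=> fq; split.
  have -> : range (f \o q) = f @` range q by rewrite image_comp.
  exact: finite_image fq.1.
by move=> v; rewrite comp_preimage; exact: fsimple_preimage.
Qed.

Lemma fsimple_cst X (x : X) : fsimple (fun=> x).
Proof.
split=> [|v]; first by apply: sub_finite_set (finite_set1 x) => _ [t _ <-].
by rewrite preimage_cst; case: ifP => _; [exact: measurableT|exact: measurable0].
Qed.

Lemma fsimple_pair X Y (p : R -> X) (q : R -> Y) :
  fsimple p -> fsimple q -> fsimple (fun t => (p t, q t)).
Proof.
move=> [fp mp] [fq mq]; split.
  apply: sub_finite_set (finite_setX fp fq) => _ [t _ <-].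
  by split; exists t.
move=> [x y]; have -> : (fun t => (p t, q t)) @^-1` [set (x, y)] =
    p @^-1` [set x] `&` q @^-1` [set y].
  by apply/seteqP; split=> t /= [<- <-].
exact: measurableI.
Qed.

(** Records finitely many simple functions as a single one, so that one colouring can be
    equidistributed on the level sets of all of them. *)
Lemma fsimple_mkseq X (q : nat -> R -> X) n :
  (forall i, fsimple (q i)) -> fsimple (fun t => mkseq (q^~ t) n).
Proof.
move=> fq; elim: n => [|n ih]; first exact: fsimple_cst.
under eq_fun do rewrite mkseqS.
exact: (fsimple_comp (fun sx => rcons sx.1 sx.2) (fsimple_pair ih (fq n))).
Qed.

Lemma fsimple_mem E : measurable E -> fsimple (fun t => t \in E).
Proof.
move=> mE; split=> [|v]; first exact: finite_finset.
have -> : (fun t => t \in E) @^-1` [set v] = if v then E else ~` E.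
  apply/seteqP; split=> t /=; case: v => /=.
  - by move/set_mem.
  - by move=> + /mem_set; move=> ->.
  - by move/mem_set.
  - by move=> h; apply/negbTE; rewrite notin_setE.
by case: v => //; exact: measurableC.
Qed.

Lemma fsimple_if X E (p q : R -> X) : measurable E -> fsimple p -> fsimple q ->
  fsimple (fun t => if t \in E then p t else q t).
Proof.
move=> mE fp fq; pose g (x : bool * (X * X)) := if x.1 then x.2.1 else x.2.2.
exact: (fsimple_comp g (fsimple_pair (fsimple_mem mE) (fsimple_pair fp fq))).
Qed.

Lemma fsimple_measurable_fun D (q : R -> R) : fsimple q -> measurable_fun D q.
Proof. by move=> fq mD Z mZ; apply: measurableI => //; exact: fsimple_preimage. Qed.


End FiniteRange.

Section StronglyMeasurable.
Variables (R : realType).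
Local Notation mu := (@lebesgue_measure R).
Implicit Types (V W : normedModType R[i]) (D E : set R).

Lemma sm_real V (g : V -> R) D (f : R -> V) :
  (forall (x_ : nat -> V) x, x_ n @[n --> \oo] --> x ->
     g (x_ n) @[n --> \oo] --> g x) ->
  strongly_measurable D f -> measurable_fun D (g \o f).
Proof.
move=> gc [s_ [fs sf]].
apply: (measurable_realfun.measurable_fun_cvg (h := fun n => g \o s_ n)).
  by move=> n; apply: fsimple_measurable_fun; exact: (fsimple_comp g (fs n)).
by move=> t Dt; apply: gc; exact: sf.
Qed.

Lemma sm_rnorm V D (f : R -> V) :
  strongly_measurable D f -> measurable_fun D (fun t => rnorm (f t)).
Proof. by apply: (@sm_real _ (@rnorm R V)) => x_ x; exact: rnorm_cvg. Qed.

Lemma sm_simple V D (s : R -> V) : fsimple s -> strongly_measurable D s.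
Proof. by move=> fs; exists (fun=> s); split => // t _; exact: cvg_cst. Qed.

Lemma sm_comp V W (g : V -> W) D (f : R -> V) :
  continuous g -> strongly_measurable D f -> strongly_measurable D (g \o f).
Proof.
move=> gc [s_ [fs sf]]; exists (fun n => g \o s_ n); split=> [n|t Dt].
  exact: (fsimple_comp g (fs n)).
by apply: continuous_cvg (sf t Dt); exact: gc.
Qed.

Lemma sm_sub V D E (f : R -> V) : E `<=` D -> strongly_measurable D f ->
  strongly_measurable E f.
Proof. by move=> ED [s_ [fs sf]]; exists s_; split => // t /ED; exact: sf. Qed.

Lemma sm_eq V D (f g : R -> V) : (forall t, D t -> f t = g t) ->
  strongly_measurable D f -> strongly_measurable D g.
Proof.
by move=> fg [s_ [fs sf]]; exists s_; split => // t Dt; rewrite -fg//; exact: sf.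
Qed.

Lemma smD V D (f g : R -> V) :
  strongly_measurable D f -> strongly_measurable D g ->
  strongly_measurable D (fun t => f t + g t).
Proof.
move=> [s_ [fs sf]] [r_ [fr rg]]; exists (fun n t => s_ n t + r_ n t).
split=> [n|t Dt]; last by apply: cvgD; [exact: sf|exact: rg].
exact: (fsimple_comp (fun x => x.1 + x.2) (fsimple_pair (fs n) (fr n))).
Qed.

Lemma smN V D (f : R -> V) :
  strongly_measurable D f -> strongly_measurable D (fun t => - f t).
Proof.
move=> [s_ [fs sf]]; exists (fun n t => - s_ n t).
split=> [n|t Dt]; last by apply: cvgN; exact: sf.
exact: (fsimple_comp (@GRing.opp V) (fs n)).
Qed.

Lemma sm_sum V D (I : Type) (r : seq I) (f : I -> R -> V) :
  (forall i, strongly_measurable D (f i)) ->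
  strongly_measurable D (fun t => \sum_(i <- r) f i t).
Proof.
move=> fm; elim: r => [|i r ih].
  by under eq_fun do rewrite big_nil; apply: sm_simple; exact: fsimple_cst.
by under eq_fun do rewrite big_cons; exact: smD.
Qed.

Lemma sm_if V D E (f g : R -> V) : measurable E ->
  strongly_measurable (D `&` E) f -> strongly_measurable (D `&` ~` E) g ->
  strongly_measurable D (fun t => if t \in E then f t else g t).
Proof.
move=> mE [s_ [fs sf]] [r_ [fr rg]].
exists (fun n t => if t \in E then s_ n t else r_ n t); split=> [n|t Dt].
  exact: (fsimple_if mE (fs n) (fr n)).
have [Et|Et] := boolP (t \in E).
  by apply: sf; split => //; exact: set_mem.
by apply: rg; split => //; rewrite notin_setE in Et.
Qed.

Lemma integrable_le D (g h : R -> R) : measurable D -> measurable_fun D h ->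
  (forall t, D t -> `|h t| <= g t) -> mu.-integrable D (EFin \o g) ->
  mu.-integrable D (EFin \o h).
Proof.
move=> mD mh hg; apply: le_integrable => //; first exact/measurable_EFinP.
by move=> t Dt /=; rewrite lee_fin (le_trans (hg t Dt))// ler_norm.
Qed.

Lemma integrable_rnorm V D (f : R -> V) : measurable D ->
  strongly_measurable D f ->
  (\int[mu]_(t in D) (rnorm (f t))%:E < +oo)%E <->
  mu.-integrable D (EFin \o (fun t => rnorm (f t))).
Proof.
move=> mD /sm_rnorm mf; have e : (\int[mu]_(t in D) (rnorm (f t))%:E =
    \int[mu]_(t in D) `|(EFin \o (fun t => rnorm (f t))) t|)%E.
  by apply: eq_integral => t _ /=; rewrite ger0_norm ?rnorm_ge0.
rewrite e; split=> [h|/integrableP[]//]; apply/integrableP; split=> //.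
exact/measurable_EFinP.
Qed.

(* Truncating the approximants at twice the norm of [f] makes the convergence
   dominated. *)
Lemma L1_approximation V D (f : R -> V) : measurable D ->
  strongly_measurable D f ->
  mu.-integrable D (EFin \o (fun t => rnorm (f t))) ->
  exists s_ : nat -> R -> V, (forall n, simple_function (s_ n)) /\
    (\int[mu]_(t in D) (rnorm (f t - s_ n t))%:E)%E @[n --> \oo] --> 0%E.
Proof.
move=> mD sf fi; have [s_ [fs sc]] := sf.
pose E n := D `&` [set t | rnorm (s_ n t) <= 2 * rnorm (f t)].
have mE n : measurable (E n).
  have ms : measurable_fun D (fun t => rnorm (s_ n t)).
    by apply: sm_rnorm; apply: sm_simple; exact: fs.
  have mf : measurable_fun D (fun t => 2 * rnorm (f t)).
    by apply: measurable_funM => //; exact: sm_rnorm.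
  exact: measurable_fun_le.
pose r_ n t := if t \in E n then s_ n t else 0.
have fr n : simple_function (r_ n).
  by apply: fsimple_if => //; [exact: fs|exact: fsimple_cst].
have bnd n t : D t -> rnorm (f t - r_ n t) <= 3 * rnorm (f t).
  move=> Dt; apply: le_trans (rnormB _ _) _; rewrite /r_; case: ifPn.
    by rewrite inE => -[_ /=]; lra.
  by rewrite rnorm0 => _; have := rnorm_ge0 (f t); lra.
have cv t : D t -> rnorm (f t - r_ n t) @[n --> \oo] --> 0.
  (* Where [f t = 0] the truncation forces [r_ n t = 0]; elsewhere [s_ n t] eventually passes the
     test defining [E n]. *)
  move=> Dt; have [ft0|ft0] := eqVneq (f t) 0.
    apply: cvg_near_cst; apply: nearW => n; apply/eqP.
    by rewrite eq_le rnorm_ge0 (le_trans (bnd n t Dt))// ft0 rnorm0 mulr0.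
  have nf : 0 < rnorm (f t) by rewrite lt_def rnorm_eq0 ft0 rnorm_ge0.
  have /rcvg0P := sc t Dt; apply: cvg_trans; apply: near_eq_cvg.
  have /rcvgP/(_ _ nf) := sc t Dt; apply: filterS => n h.
  have Et : E n t.
    by split=> //=; have := rnormD (s_ n t - f t) (f t); rewrite subrK; lra.
  by rewrite /r_ (mem_set Et) rnormC.
exists r_; split=> //.
have [|||||_ + _] := @dominated_convergence _ _ _ mu D mD
  (fun n t => (rnorm (f t - r_ n t))%:E) (cst 0%E)
  (EFin \o (fun t => 3 * rnorm (f t))).
- move=> n; apply/measurable_EFinP; apply: sm_rnorm; apply: smD => //.
  by apply: smN; apply: sm_simple; exact: fr.
- exact: measurable_cst.
- by apply: aeW => t Dt; apply: cvg_EFin; [exact: nearW|exact: cv].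
- exact: (@integrableZl _ _ _ mu D mD 3 _ fi).
- apply: aeW => t n Dt; rewrite abse_EFin lee_fin ger0_norm ?rnorm_ge0//.
  exact: bnd.
apply: cvg_trans; apply: near_eq_cvg; apply: nearW => n /=.
by apply: eq_integral => t _; rewrite subr0 ger0_norm ?rnorm_ge0.
Qed.

End StronglyMeasurable.

(** * Real integrals *)

Section RealIntegral.
Variable R : realType.
Local Notation mu := (@lebesgue_measure R).
Implicit Types (D E : set R) (f g h : R -> R).

Definition rintegrable D h := mu.-integrable D (EFin \o h).

Definition rintegral D h := \int[mu]_(t in D) h t.

Lemma EFin_rintegral D h : measurable D -> rintegrable D h ->
  (rintegral D h)%:E = (\int[mu]_(t in D) (h t)%:E)%E.
Proof. by move=> mD hi; rewrite fineK//; exact: (@integrable_fin_num _ _ _ mu). Qed.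

Lemma rintegrableD D f g : measurable D -> rintegrable D f -> rintegrable D g ->
  rintegrable D (fun t => f t + g t).
Proof. by move=> mD; exact: (@integrableD _ _ _ mu). Qed.

Lemma rintegralD D f g : measurable D -> rintegrable D f -> rintegrable D g ->
  rintegral D (fun t => f t + g t) = rintegral D f + rintegral D g.
Proof. by move=> mD; exact: (@RintegralD _ _ _ mu). Qed.

Lemma rintegrableZ D f a : measurable D -> rintegrable D f ->
  rintegrable D (fun t => a * f t).
Proof. by move=> mD; exact: (@integrableZl _ _ _ mu). Qed.

Lemma rintegralZ D f a : measurable D -> rintegrable D f ->
  rintegral D (fun t => a * f t) = a * rintegral D f.
Proof. by move=> mD; exact: (@RintegralZl _ _ _ mu). Qed.

Lemma rintegrable_eq D f g : measurable D -> (forall t, D t -> f t = g t) ->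
  rintegrable D f -> rintegrable D g.
Proof.
move=> mD fg; apply: (@eq_integrable _ _ _ mu) => // t /set_mem Dt /=.
by rewrite fg.
Qed.

Lemma rintegral_eq D f g : (forall t, D t -> f t = g t) ->
  rintegral D f = rintegral D g.
Proof. by move=> fg; apply: eq_Rintegral => t /set_mem; exact: fg. Qed.

Lemma rintegral_le D f g : measurable D -> rintegrable D f -> rintegrable D g ->
  (forall t, D t -> f t <= g t) -> rintegral D f <= rintegral D g.
Proof. by move=> mD; exact: (@le_Rintegral _ _ _ mu). Qed.

Lemma rintegral_norm D f : measurable D -> rintegrable D f ->
  `|rintegral D f| <= rintegral D (fun t => `|f t|).
Proof. by move=> mD; exact: (@le_normr_Rintegral _ _ _ mu). Qed.

Lemma rintegrable_norm D f : measurable D -> rintegrable D f ->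
  rintegrable D (fun t => `|f t|).
Proof. by move=> mD; exact: (@integrable_norm _ _ _ mu). Qed.

Lemma rintegrable_le D f g : measurable D -> measurable_fun D f ->
  (forall t, D t -> `|f t| <= g t) -> rintegrable D g -> rintegrable D f.
Proof. exact: integrable_le. Qed.

Lemma rintegrable_meas D f : rintegrable D f -> measurable_fun D f.
Proof. by move=> /integrableP[/measurable_EFinP]. Qed.

Lemma rintegrableS D E f : measurable E -> measurable D -> D `<=` E ->
  rintegrable E f -> rintegrable D f.
Proof. by move=> mE mD; exact: (@integrableS _ _ _ mu). Qed.

Lemma rintegral_setU D E f : measurable D -> measurable E ->
  D `&` E = set0 -> rintegrable (D `|` E) f ->
  rintegral (D `|` E) f = rintegral D f + rintegral E f.
Proof.
move=> mD mE DE fi; apply: (@Rintegral_setU _ _ _ mu) => //.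
by apply/disj_setPLR; apply/disjoints_subset.
Qed.

Lemma rintegrable_sum D (I : Type) (r : seq I) (f : I -> R -> R) : measurable D ->
  (forall i, rintegrable D (f i)) -> rintegrable D (fun t => \sum_(i <- r) f i t).
Proof.
move=> mD fi; have := @integrable_sum _ _ _ mu D mD _ r xpredT _ (fun i _ => fi i).
by apply: eq_ind; congr (_.-integrable); apply/funext => t/=; rewrite -sumEFin.
Qed.

Lemma rintegral_sum D (I : Type) (r : seq I) (f : I -> R -> R) : measurable D ->
  (forall i, rintegrable D (f i)) ->
  rintegral D (fun t => \sum_(i <- r) f i t) = \sum_(i <- r) rintegral D (f i).
Proof.
move=> mD fi; elim: r => [|i r ih].
  rewrite big_nil -[RHS](mul0r (rintegral D (cst 0))).
  rewrite -rintegralZ//; last exact: (@integrable0 _ _ _ mu).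
  by apply: rintegral_eq => t _; rewrite big_nil mul0r.
rewrite big_cons -ih -rintegralD//; last exact: rintegrable_sum.
by apply: rintegral_eq => t _; rewrite big_cons.
Qed.

Lemma rintegrable_cst D a : measurable D -> (mu D < +oo)%E ->
  rintegrable D (fun=> a).
Proof.
move=> mD Doo; apply: (@measurable_bounded_integrable _ _ _ mu) => //.
exists `|a|; split; first by rewrite num_real.
by move=> x ax t _ /=; exact: ltW.
Qed.


Lemma rintegral_ge0 D f : (forall t, D t -> 0 <= f t) -> 0 <= rintegral D f.
Proof. by move=> f0; apply: (@Rintegral_ge0 _ _ _ mu). Qed.

Lemma rintegrable_indic D E : measurable D -> (mu D < +oo)%E -> measurable E ->
  rintegrable D (\1_E).
Proof.
move=> mD Doo mE; apply: rintegrable_le (rintegrable_cst 1 mD Doo) => //.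
by move=> t _; rewrite indicE ger0_norm// lern1 leq_b1.
Qed.

Lemma rintegral_indic D E : measurable D -> measurable E ->
  rintegral D (\1_E) = fine (mu (D `&` E)).
Proof.
by move=> mD mE; rewrite /rintegral /Rintegral (@integral_indic _ _ _ mu)// setIC.
Qed.

(** [g \o q] is a combination of indicators of level sets of [q]. The codomain is arbitrary so that
    [q] may be a sequence of vectors. *)
Lemma rintegral_fsimple (X : choiceType) D (q : R -> X) (g : X -> R) :
  measurable D -> (mu D < +oo)%E -> fsimple q ->
  rintegrable D (g \o q) /\
  rintegral D (g \o q) = \sum_(v \in range q) g v * fine (mu (D `&` q @^-1` [set v])).
Proof.
move=> mD Doo fq; have [fr mq] := fq; rewrite fsbig_finite//=.
set r := finmap.enum_fset _.
have e t : (g \o q) t = \sum_(v <- r) g v * \1_(q @^-1` [set v]) t.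
  rewrite (bigD1_seq (q t))/= ?finmap.fset_uniq//; last first.
    by rewrite in_fset_set// mem_set//; exists t.
  rewrite indicE mem_set// mulr1 big1 ?addr0// => v vt.
  by rewrite indicE memNset ?mulr0//= => vE; move: vt; rewrite vE eqxx.
have ii v : rintegrable D (fun t => g v * \1_(q @^-1` [set v]) t).
  by apply: rintegrableZ => //; exact: rintegrable_indic.
split.
  apply: (rintegrable_eq mD (fun t _ => esym (e t))).
  exact: rintegrable_sum.
rewrite (rintegral_eq (fun t _ => e t)) rintegral_sum//.
apply: eq_bigr => v _; rewrite rintegralZ ?rintegral_indic//.
exact: rintegrable_indic.
Qed.

(** The pushforward under the translation agrees with Lebesgue measure on half-open intervals, which
    determine it. *)
Lemma lebesgue_measure_shift (a : R) E : measurable E ->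
  mu ((fun t => t + a) @^-1` E) = mu E.
Proof.
move=> mE.
have ms : measurable_fun (setT : set (measurableTypeR R))
    (fun t : measurableTypeR R => (t + a : measurableTypeR R)).
  exact: measurable_funD.
apply/esym; apply: (@lebesgue_measure_unique R
  (pushforward mu (fun t : measurableTypeR R => (t + a : measurableTypeR R)))) => //.
move=> X /ocitvP[->|[[x y] /= xy ->]]; first by rewrite !measure0.
rewrite /pushforward.
have -> : (fun t : R => t + a) @^-1` `]x, y] = `]x - a, y - a]%classic.
  by apply/seteqP; split=> t /=; rewrite !in_itv/= ltrBlDr lerBrDr.
rewrite !lebesgue_measure_itv/= !lte_fin ltrD2r; case: ifP => // _.
by rewrite !EFinB; congr (_%:E); rewrite opprB addrA subrK.
Qed.

Lemma ge0_integral_shift (a : R) D h : measurable D -> measurable_fun D h ->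
  (forall t, D t -> 0 <= h t) ->
  (\int[mu]_(t in (fun t => (t + a)%R) @^-1` D) (h (t + a)%R)%:E =
   \int[mu]_(t in D) (h t)%:E)%E.
Proof.
move=> mD mh h0.
have ms : measurable_fun (setT : set (measurableTypeR R))
    (fun t : measurableTypeR R => (t + a : measurableTypeR R)).
  exact: measurable_funD.
rewrite -(@ge0_integral_pushforward _ _ _ _ R _ ms mu D (EFin \o h))//.
- apply: eq_measure_integral => E mE _; exact: lebesgue_measure_shift.
- exact/measurable_EFinP.
- by move=> t /set_mem Dt; rewrite /= lee_fin h0.
Qed.

Lemma measurable_shift (a : R) D : measurable D ->
  measurable ((fun t => t + a) @^-1` D).
Proof.
have ms : measurable_fun (setT : set R) (fun t : R => t + a).
  exact: measurable_funD.
by move=> mD; rewrite -[X in measurable X]setTI; exact: ms.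
Qed.

(** The change of variables for non-negative functions applies to [|h|] and to [h + |h|], whose
    difference gives [h]. *)
Lemma rintegral_shift (a : R) D h : measurable D -> rintegrable D h ->
  rintegrable ((fun t => t + a) @^-1` D) (fun t => h (t + a)) /\
  rintegral D h = rintegral ((fun t => t + a) @^-1` D) (fun t => h (t + a)).
Proof.
move=> mD hi; set D' := (_ @^-1` D).
have mD' : measurable D' by exact: measurable_shift.
have meas (k : R -> R) : measurable_fun D k -> measurable_fun D' (fun t => k (t + a)).
  move=> mk; apply: (measurable_comp mD _ mk) => [_ [t Dt <-]//|].
  by apply: measurable_funTS; exact: measurable_funD.
have pos (k : R -> R) : rintegrable D k -> (forall t, 0 <= k t) ->
    rintegrable D' (fun t => k (t + a)) /\
    rintegral D k = rintegral D' (fun t => k (t + a)).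
  move=> ki k0; have mk := rintegrable_meas ki.
  have e := ge0_integral_shift a mD mk (fun t _ => k0 t).
  split; last by rewrite /rintegral /Rintegral -e.
  apply/integrableP; split; first by apply/measurable_EFinP; exact: meas.
  have -> : (\int[mu]_(t in D') `|(EFin \o (fun t => k (t + a)%R)) t| =
             \int[mu]_(t in D) (k t)%:E)%E.
    by rewrite -e; apply: eq_integral => t _ /=; rewrite ger0_norm.
  by rewrite -EFin_rintegral// ltry.
have ai := rintegrable_norm mD hi.
have bi := rintegrableD mD hi ai.
have [a1 a2] := pos _ ai (fun t => normr_ge0 _).
have [|b1 b2] := pos _ bi.
  by move=> t; rewrite addrC -lerBlDr sub0r -normrN ler_norm.
have e D0 (g : R -> R) : measurable D0 ->
    rintegrable D0 (fun t => `|g t|) -> rintegrable D0 (fun t => g t + `|g t|) ->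
    rintegrable D0 g /\
    rintegral D0 g = rintegral D0 (fun t => g t + `|g t|) - rintegral D0 (fun t => `|g t|).
  move=> mD0 gi gi'.
  have ee t : D0 t -> g t + `|g t| + (-1) * `|g t| = g t by rewrite mulN1r addrK.
  have ni := rintegrableZ (-1) mD0 gi; split.
    by apply: rintegrable_eq ee _ => //; exact: rintegrableD.
  by rewrite -(rintegral_eq ee) rintegralD// rintegralZ// mulN1r.
have [c1 c2] := e _ _ mD' a1 b1.
split=> //; rewrite c2 -a2 -b2; exact: (e _ _ mD ai bi).2.
Qed.

End RealIntegral.

(** * Weak and Bochner integrals *)

Section WeakIntegral.
Variables (R : realType) (H : hilbertType R).
Local Notation mu := (@lebesgue_measure R).
Implicit Types (D E : set R) (f g : R -> H) (v w z : H).

Definition finite_domain D := measurable D /\ (mu D < +oo)%E.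

(** A Pettis integral, tested through real parts. Sums, restrictions, translations and bounded
    operators are then handled by real integration, with no simple approximation in sight. *)
Definition weak_integral D f v := forall z,
  rintegrable D (fun t => rinner (f t) z) /\
  rinner v z = rintegral D (fun t => rinner (f t) z).

Lemma weak_integral_eq D f g v : measurable D -> (forall t, D t -> f t = g t) ->
  weak_integral D f v -> weak_integral D g v.
Proof.
move=> mD fg fv z; have [h1 h2] := fv z; split.
  by apply: rintegrable_eq h1 => // t /fg ->.
by rewrite h2; apply: rintegral_eq => t /fg ->.
Qed.

Lemma weak_integral_uniq D f v w :
  weak_integral D f v -> weak_integral D f w -> v = w.
Proof. by move=> fv fw; apply: rinner_inj => z; rewrite (fv z).2 (fw z).2. Qed.

Lemma weak_integralD D f g v w : measurable D ->
  weak_integral D f v -> weak_integral D g w ->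
  weak_integral D (fun t => f t + g t) (v + w).
Proof.
move=> mD fv gw z; have [h1 h2] := fv z; have [k1 k2] := gw z.
have e t : D t -> rinner (f t) z + rinner (g t) z = rinner (f t + g t) z.
  by rewrite rinnerDl.
split; first by apply: rintegrable_eq e _ => //; exact: rintegrableD.
by rewrite -(rintegral_eq e) rintegralD// rinnerDl h2 k2.
Qed.

Lemma weak_integralZ D f v (a : R) : measurable D ->
  weak_integral D f v -> weak_integral D (fun t => a%:C *: f t) (a%:C *: v).
Proof.
move=> mD fv z; have [h1 h2] := fv z.
have e t : D t -> a * rinner (f t) z = rinner (a%:C *: f t) z.
  by rewrite rinnerZl.
split; first by apply: rintegrable_eq e _ => //; exact: rintegrableZ.
by rewrite -(rintegral_eq e) rintegralZ// rinnerZl h2.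
Qed.

Lemma weak_integralB D f g v w : measurable D ->
  weak_integral D f v -> weak_integral D g w ->
  weak_integral D (fun t => f t - g t) (v - w).
Proof.
move=> mD fv /(weak_integralZ (-1) mD) gw.
have e (x : H) : (-1 : R)%:C *: x = - x by rewrite rmorphN rmorph1 scaleN1r.
have := weak_integralD mD fv gw; rewrite e.
by apply: weak_integral_eq => // t _; rewrite e.
Qed.

Lemma weak_integral_sum D (I : Type) (r : seq I) (f : I -> R -> H) (v : I -> H) :
  measurable D -> (forall i, weak_integral D (f i) (v i)) ->
  weak_integral D (fun t => \sum_(i <- r) f i t) (\sum_(i <- r) v i).
Proof.
move=> mD fv z; have e t : D t ->
    \sum_(i <- r) rinner (f i t) z = rinner (\sum_(i <- r) f i t) z.
  by rewrite rinner_suml.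
have fi i := (fv i z).1; split.
  by apply: rintegrable_eq e _ => //; exact: rintegrable_sum.
rewrite -(rintegral_eq e) rintegral_sum// rinner_suml.
by apply: eq_bigr => i _; exact: (fv i z).2.
Qed.

(** The adjoint carries [T] over to the test vector. *)
Lemma weak_integral_op D f v (T : H -> H) : measurable D -> bounded_op T ->
  weak_integral D f v -> weak_integral D (T \o f) (T v).
Proof.
move=> mD /adjoint_exists[T' _ TT'] fv z.
have e x : rinner (T x) z = rinner x (T' z) by rewrite /rinner TT'.
have [h1 h2] := fv (T' z); split.
  by apply: rintegrable_eq h1 => // t _ /=; rewrite e.
by rewrite e h2; apply: rintegral_eq => t _ /=; rewrite e.
Qed.

Lemma weak_integral_setU D E f v w : measurable D -> measurable E ->
  D `&` E = set0 -> weak_integral D f v -> weak_integral E f w ->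
  (forall z, rintegrable (D `|` E) (fun t => rinner (f t) z)) ->
  weak_integral (D `|` E) f (v + w).
Proof.
move=> mD mE DE fv fw fi z; split=> //.
by rewrite rintegral_setU// rinnerDl (fv z).2 (fw z).2.
Qed.

Lemma weak_integral0 D f : measurable D -> (forall t, D t -> f t = 0) ->
  weak_integral D f 0.
Proof.
move=> mD f0 z; have e t : D t -> 0 = rinner (f t) z.
  by move=> /f0 ->; rewrite rinner0l.
split; first by apply: rintegrable_eq e _ => //; exact: (@integrable0 _ _ _ mu).
rewrite rinner0l -(rintegral_eq e) /rintegral -[RHS]/(fine _).
by rewrite (@integral0 _ _ _ mu).
Qed.

(** Test against [v] itself, then divide by [rnorm v]. *)
Lemma weak_integral_norm D f v (g : R -> R) : measurable D ->
  weak_integral D f v -> rintegrable D g ->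
  (forall t, D t -> rnorm (f t) <= g t) -> rnorm v <= rintegral D g.
Proof.
move=> mD fv gi fg; have [->|v0] := eqVneq v 0.
  rewrite rnorm0; apply: rintegral_ge0 => t /fg; apply: le_trans.
  exact: rnorm_ge0.
have nv : 0 < rnorm v by rewrite lt_def rnorm_eq0 v0 rnorm_ge0.
rewrite -(ler_pM2l nv) -expr2 -rinner_norm; have [h1 ->] := fv v.
rewrite -rintegralZ//; apply: rintegral_le => //; first exact: rintegrableZ.
move=> t Dt; apply: le_trans (ler_norm _) _; apply: le_trans (rinner_le _ _) _.
by rewrite mulrC ler_wpM2l ?rnorm_ge0// fg.
Qed.

Lemma weak_integral_simple D f : finite_domain D -> simple_function f ->
  weak_integral D f (simple_integral D f).
Proof.
move=> [mD Doo] ff z.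
have [h1 h2] := rintegral_fsimple (fun x : H => rinner x z) mD Doo ff; split=> //.
rewrite -[RHS]/(rintegral D ((fun x : H => rinner x z) \o f)) h2 /simple_integral.
have [fr _] := ff; rewrite !fsbig_finite//= rinner_suml.
by apply: eq_bigr => v _; rewrite rinnerZl mulrC.
Qed.

Lemma sm_rinner D f z : strongly_measurable D f ->
  measurable_fun D (fun t => rinner (f t) z).
Proof.
by apply: (@sm_real _ _ (fun x : H => rinner x z)) => x_ x; exact: rinner_cvg.
Qed.

Lemma rintegrable_rinner D f z : measurable D -> strongly_measurable D f ->
  rintegrable D (fun t => rnorm (f t)) ->
  rintegrable D (fun t => rinner (f t) z).
Proof.
move=> mD sf fi; apply: rintegrable_le (rintegrableZ (rnorm z) mD fi) => //.
  exact: sm_rinner.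
by move=> t _; rewrite mulrC; exact: rinner_le.
Qed.

(** Convergence to 0 in the extended reals makes the integral of [|f - s_ n|] finite for some [n],
    and a simple function is integrable on a set of finite measure. *)
Lemma bochner_rintegrable D f v : finite_domain D ->
  bochner_integral D f v -> rintegrable D (fun t => rnorm (f t)).
Proof.
move=> [mD Doo] [sf [s_ [fs sf0 _]]].
have /fine_cvgP[[n _ /(_ n (leqnn n))/= hn] _] := sf0.
have dsm : strongly_measurable D (fun t => f t - s_ n t).
  by apply: smD => //; apply: smN; apply: sm_simple; exact: fs.
have di : rintegrable D (fun t => rnorm (f t - s_ n t)).
  by apply/integrable_rnorm => //; move: hn; rewrite fin_numE ltey => /andP[].
have si : rintegrable D (fun t => rnorm (s_ n t)).
  exact: (rintegral_fsimple (@rnorm R H) mD Doo (fs n)).1.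
apply: rintegrable_le (rintegrableD mD di si) => //; first exact: sm_rnorm.
move=> t _; rewrite ger0_norm ?rnorm_ge0//; apply: le_trans (rnormD _ _).
by rewrite subrK.
Qed.

Lemma L1_rintegral_cvg D f (s_ : nat -> R -> H) : measurable D ->
  strongly_measurable D f ->
  (forall n, simple_function (s_ n)) ->
  (\int[mu]_(t in D) (rnorm (f t - s_ n t))%:E)%E @[n --> \oo] --> 0%E ->
  (\forall n \near \oo, rintegrable D (fun t => rnorm (f t - s_ n t))) /\
  rintegral D (fun t => rnorm (f t - s_ n t)) @[n --> \oo] --> 0.
Proof.
move=> mD sf fs /fine_cvgP[h1 h2]; split => //.
apply: filterS h1 => n hn; apply/integrable_rnorm => //.
  by apply: smD => //; apply: smN; apply: sm_simple; exact: fs.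
by move: hn; rewrite fin_numE ltey => /andP[].
Qed.

(** The identity holds for the simple approximants, and replacing [f] with [s_ n] costs at most
    [rnorm z] times the integral of [|f - s_ n|]. *)
Lemma bochner_weak D f v : finite_domain D ->
  bochner_integral D f v -> weak_integral D f v.
Proof.
move=> fD fv; have fi := bochner_rintegrable fD fv; have [mD Doo] := fD.
have [sf [s_ [fs sf0 sv]]] := fv; move=> z.
have ri := rintegrable_rinner z mD sf fi; split=> //.
have [di d0] := L1_rintegral_cvg mD sf fs sf0.
have c1 : rinner (simple_integral D (s_ n)) z @[n --> \oo] --> rinner v z.
  exact: rinner_cvg.
apply/esym; apply: (cvg_unique _ _ c1) => //.
apply/cvgrPdist_le => e e0.
have z0 : 0 < rnorm z + 1 by rewrite ltr_wpDl ?rnorm_ge0.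
move/cvgr0Pnorm_lt : d0 => /(_ (e / (rnorm z + 1)) (divr_gt0 e0 z0)).
apply: filterS2 di => n di; rewrite ger0_norm; last first.
  by apply: rintegral_ge0 => t _; exact: rnorm_ge0.
rewrite ltr_pdivlMr// => de.
have [si ->] := weak_integral_simple fD (fs n) z.
have e1 : rintegral D (fun t => rinner (f t) z) -
  rintegral D (fun t => rinner (s_ n t) z) =
  rintegral D (fun t => rinner (f t - s_ n t) z).
  apply/eqP; rewrite subr_eq -rintegralD//; last first.
    apply: rintegrable_eq (rintegrableD mD ri (rintegrableZ (-1) mD si)) => //.
    by move=> t _; rewrite rinnerBl mulN1r.
  by apply/eqP; apply: rintegral_eq => t _; rewrite rinnerBl subrK.
have dri : rintegrable D (fun t => rinner (f t - s_ n t) z).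
  apply: rintegrable_rinner => //.
  by apply: smD => //; apply: smN; apply: sm_simple; exact: fs.
rewrite e1 (le_trans (rintegral_norm mD dri))//.
apply: le_trans (ltW (le_lt_trans _ de)) => //.
apply: (@le_trans _ _ (rintegral D (fun t => rnorm z * rnorm (f t - s_ n t)))).
  apply: rintegral_le => //; first exact: rintegrable_norm.
    exact: rintegrableZ.
  by move=> t _; rewrite mulrC; exact: rinner_le.
rewrite rintegralZ// mulrC ler_wpM2l ?lerDl//.
by apply: rintegral_ge0 => t _; exact: rnorm_ge0.
Qed.

(** By [weak_integral_norm], the integrals of the L1 approximants form a Cauchy sequence in the
    complete space [H]. *)
Lemma bochner_exists D f : finite_domain D -> strongly_measurable D f ->
  rintegrable D (fun t => rnorm (f t)) -> exists v, bochner_integral D f v.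
Proof.
move=> fD sf fi; have [mD Doo] := fD.
have [s_ [fs sf0]] := L1_approximation mD sf fi.
have [di d0] := L1_rintegral_cvg mD sf fs sf0.
have [v sv] : exists v : H, simple_integral D (s_ n) @[n --> \oo] --> v.
  apply: rcauchy_cvg => e e0.
  move/cvgr0Pnorm_lt : d0 => /(_ (e / 2) (divr_gt0 e0 (ltr0n _ 2))) d0.
  have [N _ hN] : \forall n \near \oo, `|rintegral D (fun t => rnorm (f t - s_ n t))| < e / 2
      /\ rintegrable D (fun t => rnorm (f t - s_ n t)) by exact: filterI.
  exists N => p q /hN /= [hp pi] /hN /= [hq qi].
  have w := weak_integralB mD (weak_integral_simple fD (fs p))
     (weak_integral_simple fD (fs q)).
  apply: le_lt_trans (weak_integral_norm mD w (rintegrableD mD pi qi) _) _.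
    move=> t _; rewrite rnormC [leRHS]addrC.
    have -> : s_ q t - s_ p t = - (f t - s_ q t) + (f t - s_ p t).
      by rewrite opprB subrKA.
    by apply: le_trans (rnormD _ _) _; rewrite rnormN.
  rewrite rintegralD//; move: hp hq => /ltr_normlP[_ hp] /ltr_normlP[_ hq]; lra.
by exists v; split => //; exists s_.
Qed.

Lemma weak_integral_shift (a : R) D f v : measurable D ->
  weak_integral D f v ->
  weak_integral ((fun t => t + a) @^-1` D) (fun t => f (t + a)) v.
Proof.
by move=> mD fv z; have [fi ->] := fv z; have [] := rintegral_shift a mD fi.
Qed.

End WeakIntegral.

(** * Chattering *)

Section Chattering.
Variable R : realType.
Local Notation mu := (@lebesgue_measure R).
Implicit Types (D E F : set R).

Lemma rintegral_restrict D E (h : R -> R) : measurable D -> measurable E ->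
  rintegrable (D `&` E) h ->
  rintegrable D (fun t => if t \in E then h t else 0) /\
  rintegral D (fun t => if t \in E then h t else 0) = rintegral (D `&` E) h.
Proof.
move=> mD mE hi.
have e : (fun t => if t \in E then h t else 0) = h \_ E.
  by apply/funext => t; rewrite patchE.
rewrite e; split; last by rewrite /rintegral Rintegral_mkcondr.
apply: (@integrable_mkcond _ _ _ mu D (EFin \o (h \_ E)) mD).2.
have mDE := measurableI _ _ mD mE.
have := (@integrable_mkcond _ _ _ mu (D `&` E) (EFin \o h) mDE).1 hi.
suff -> : (EFin \o h) \_ (D `&` E) = (EFin \o h \_ E) \_ D by [].
by apply/funext => t; rewrite /= !patchE /= ?patchE in_setI; case: (t \in D); case: (t \in E).
Qed.

Lemma weak_integral_restrict (H : hilbertType R) D E (f : R -> H) v :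
  measurable D -> measurable E -> weak_integral (D `&` E) f v ->
  weak_integral D (fun t => if t \in E then f t else 0) v.
Proof.
move=> mD mE fv z; have [h1 h2] := fv z.
have [k1 k2] := rintegral_restrict mD mE h1.
have e t : D t -> (if t \in E then rinner (f t) z else 0) =
    rinner (if t \in E then f t else 0) z.
  by case: ifP => // _ _; rewrite rinner0l.
split; first exact: rintegrable_eq e k1.
by rewrite h2 -k2; exact: rintegral_eq.
Qed.

Lemma finite_domain_itv (a b : R) : finite_domain `]a, b[%classic.
Proof.
split; first exact: measurable_itv.
by rewrite lebesgue_measure_itv/=; case: ifP => _; rewrite -?EFinB ltry.
Qed.

Lemma finite_domainS D E : measurable D -> D `<=` E -> finite_domain E ->
  finite_domain D.
Proof.
move=> mD DE [mE Eoo]; split=> //; apply: le_lt_trans Eoo.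
by apply: le_measure; rewrite ?inE.
Qed.

(** The function [r |-> mu (F]&[]-oo, r])] is 1-Lipschitz and increases from 0 to [mu F] on
    [[0, L]]; the intermediate value theorem gives the cut. *)
Lemma measure_portion F (L q : R) : measurable F -> F `<=` `]0, L[ ->
  0 <= q <= 1 ->
  exists E, [/\ measurable E, E `<=` F & fine (mu E) = q * fine (mu F)].
Proof.
move=> mF FL /andP[q0 q1].
have [L0|L0] := ltP L 0.
  exists set0; split=> //.
  have -> : F = set0.
    apply/seteqP; split=> // t /FL/=; rewrite in_itv/= => /andP[t0 tL].
    by move: (lt_trans (lt_trans t0 tL) L0); rewrite ltxx.
  by rewrite measure0 mulr0.
have [_ Foo] := finite_domainS mF FL (finite_domain_itv 0 L).
pose G r := fine (mu (F `&` `]-oo, r])).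
have mFr r : measurable (F `&` `]-oo, r]) by apply: measurableI.
have fin E : measurable E -> E `<=` F -> mu E \is a fin_num.
  move=> mE EF; rewrite ge0_fin_numE//; apply: le_lt_trans Foo.
  by apply: le_measure; rewrite ?inE.
have GD r s : r <= s -> G s = G r + fine (mu (F `&` `]r, s])).
  move=> rs; have mrs : measurable (F `&` `]r, s]) by apply: measurableI.
  rewrite /G -fineD; [|by apply: fin => // t []..].
  have disj : F `&` `]-oo, r] `&` (F `&` `]r, s]) = set0.
    apply/seteqP; split=> // t [[_ /=]]; rewrite in_itv/= => tr [_ /=].
    by rewrite in_itv/= => /andP[/lt_le_trans/(_ tr)]; rewrite ltxx.
  rewrite -(measureU mu (mFr r) mrs disj).
  congr (fine (mu _)); rewrite -setIUr; congr (_ `&` _).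
  apply/seteqP; split=> t /=; rewrite !in_itv/=.
    by move=> ->; rewrite andbT; have [tr|tr] := leP t r; [left|right].
  by move=> [tr|/andP[]//]; exact: le_trans rs.
have Glip r s : r <= s -> `|G s - G r| <= s - r.
  move=> rs; rewrite (GD r s rs) addrAC subrr add0r ger0_norm ?fine_ge0//.
  have mrs : measurable (F `&` `]r, s]) by apply: measurableI.
  have le1 : (mu (F `&` `]r, s]) <= (s - r)%:E)%E.
    apply: (@le_trans _ _ (mu `]r, s]%classic)).
      by apply: le_measure; rewrite ?inE//; exact: subIsetr.
    by rewrite lebesgue_measure_itv/= lte_fin; case: ltP => // _; rewrite lee_fin subr_ge0.
  by rewrite -lee_fin fineK//; apply: fin => // t [].
have Gc : continuous G.
  move=> r; apply/cvgrPdist_le => e e0.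
  apply/nbhs_ballP; exists e => //= s; rewrite /ball/= => rs.
  have [h|h] := leP r s.
    by rewrite distrC (le_trans (Glip _ _ h))// -(ger0_norm (_ : 0 <= s - r)) ?subr_ge0// distrC ltW.
  by rewrite (le_trans (Glip _ _ (ltW h)))// -(ger0_norm (_ : 0 <= r - s)) ?subr_ge0 ?ltW.
have G0 : G 0 = 0.
  rewrite /G (_ : _ `&` _ = set0) ?measure0//.
  apply/seteqP; split=> // t [/FL/=]; rewrite !in_itv/= => /andP[t0 _] t0'.
  by move: (lt_le_trans t0 t0'); rewrite ltxx.
have GL : G L = fine (mu F).
  congr (fine (mu _)); apply/seteqP; split=> [t []//|t Ft]; split=> //.
  by have /= := FL _ Ft; rewrite !in_itv/= => /andP[_ /ltW].
have F0 : 0 <= fine (mu F) by rewrite fine_ge0.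
have [||r _ Gr] := @IVT _ G 0 L (q * fine (mu F)) L0.
- by apply: continuous_subspaceT.
- rewrite G0 GL min_l// max_r// mulr_ge0//=.
  by rewrite ler_piMl.
by exists (F `&` `]-oo, r]); split=> // t [].
Qed.

(** Induction on the number of colours: the last colour takes the fraction [1 / (n + 2)] of [F], and
    the others share the rest equally. *)
Lemma equal_coloring n F (L : R) : measurable F -> F `<=` `]0, L[ ->
  exists c : R -> nat, [/\ fsimple c, forall t, (c t <= n)%N &
    forall j, (j <= n)%N -> fine (mu (F `&` c @^-1` [set j])) = fine (mu F) / n.+1%:R].
Proof.
elim: n F => [|n ih] F mF FL.
  exists (fun=> 0%N); split=> //; first exact: fsimple_cst.
  move=> j; rewrite leqn0 => /eqP ->; rewrite divr1; congr (fine (mu _)).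
  by apply/seteqP; split=> [t []//|t Ft]; split.
have [|E [mE EF muE]] := @measure_portion F L (n.+2%:R^-1) mF FL.
  by rewrite invr_ge0 ler0n/= invf_le1// ler1n.
have [] := ih (F `\` E); [exact: measurableD|by move=> t [/FL]|].
move=> c [fc cn muc].
have [_ Foo] := finite_domainS mF FL (finite_domain_itv 0 L).
exists (fun t => if t \in E then n.+1 else c t); split.
- by apply: fsimple_if => //; exact: fsimple_cst.
- by move=> t; case: ifP => // _; rewrite (leq_trans (cn t)).
move=> j; rewrite leq_eqVlt => /predU1P[->|jn].
  rewrite mulrC -muE; congr (fine (mu _)); apply/seteqP; split=> t /=.
    by case: ifPn => [/set_mem//|_ [_ h]]; have := cn t; rewrite h ltnn.
  by move=> Et; rewrite mem_set//; split=> //; exact: EF.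
transitivity (fine (mu ((F `\` E) `&` c @^-1` [set j]))).
  congr (fine (mu _)); apply/seteqP; split=> t /=.
    case: ifPn => [_ [_ h]|]; first by move: jn; rewrite -h ltnn.
    by rewrite notin_setE => Et [].
  by move=> [[Ft Et] h]; rewrite memNset.
rewrite muc// measureD// (setIidr EF) fineB; last 2 first.
- by rewrite ge0_fin_numE.
- rewrite ge0_fin_numE//; apply: le_lt_trans Foo.
  by apply: le_measure; rewrite ?inE.
rewrite muE; have n1 : (n.+1%:R : R) != 0 by rewrite pnatr_eq0.
have n2 : (n.+2%:R : R) != 0 by rewrite pnatr_eq0.
rewrite -natr1 in n2 *; move: (fine _) (n.+1%:R) n1 n2 => m a a0 a1.
by field; rewrite a0 a1.
Qed.

(** Each level set of [q] is coloured on its own; the range of [q] being finite, the colouring glued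
    along [q] stays measurable. *)
Lemma equal_joint_coloring (X : Type) n (q : R -> X) (L : R) : fsimple q ->
  exists c : R -> nat, [/\ fsimple c, forall t, (c t <= n)%N &
    forall x j, (j <= n)%N ->
      fine (mu (`]0, L[ `&` c @^-1` [set j] `&` q @^-1` [set x])) =
      fine (mu (`]0, L[ `&` q @^-1` [set x])) / n.+1%:R].
Proof.
move=> fq; have [fr mq] := fq.
have mI : measurable (`]0, L[%classic : set R) by exact: measurable_itv.
have /choice[c hc] x := @equal_coloring n (`]0, L[ `&` q @^-1` [set x]) L
  (measurableI _ _ mI (mq x)) (@subIsetl _ _ _).
exists (fun t => c (q t) t); split.
- split.
    apply: (@sub_finite_set _ _ `I_n.+1) => // _ [t _ <-] /=.
    by have [_ h _] := hc (q t); rewrite ltnS.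
  move=> j; have -> : (fun t => c (q t) t) @^-1` [set j] =
     \bigcup_(x in range q) (q @^-1` [set x] `&` c x @^-1` [set j]).
    apply/seteqP; split=> [t /= h|t [x _ [/= <- h]]//].
    by exists (q t) => //; exists t.
  apply: fin_bigcup_measurable => // x _; apply: measurableI; first exact: mq.
  by have [[_ mc] _ _] := hc x.
- by move=> t; have [_ h _] := hc (q t).
move=> x j jn; have [_ _ /(_ j jn) <-] := hc x.
congr (fine (mu _)); apply/seteqP; split=> t /=.
  by move=> [[It h] <-]; split.
by move=> [[It <-] h]; split.
Qed.

Variable H : hilbertType R.

(** For simple functions, keeping only the times of colour [i] and multiplying by the number of
    colours leaves the integral unchanged as soon as the colours are equidistributed on each level
    set. The general case differs by the L1 approximation error. *)
Lemma chattering n (f : 'I_n.+1 -> R -> H) (v : 'I_n.+1 -> H) (L e : R) : 0 < e ->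
  (forall i, bochner_integral `]0, L[ (f i) (v i)) ->
  exists c : R -> nat, [/\ fsimple c, forall t, (c t <= n)%N &
    forall i : 'I_n.+1, exists2 v', weak_integral `]0, L[
        (fun t => if c t == i then n.+1%:R%:C *: f i t else 0) v' &
      rnorm (v' - v i) <= e].
Proof.
move=> e0 fv; set D : set R := `]0, L[%classic.
have fD : finite_domain D := finite_domain_itv 0 L.
have mD := fD.1.
(* The approximation error enters once on the whole interval, and once more multiplied by [n + 1] on
   the times of colour [i]. *)
have e1 : 0 < e / n.+2%:R by rewrite divr_gt0.
have /choice[s hs] i : exists s : R -> H, [/\ simple_function s,
    rintegrable D (fun t => rnorm (f i t - s t)) &
    rintegral D (fun t => rnorm (f i t - s t)) <= e / n.+2%:R].
  have fi := bochner_rintegrable fD (fv i).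
  have [sf _] := fv i.
  have [s_ [fs sf0]] := L1_approximation mD sf fi.
  have [[N1 _ h1] /cvgr0Pnorm_lt/(_ _ e1)[N2 _ h2]] := L1_rintegral_cvg mD sf fs sf0.
  exists (s_ (maxn N1 N2)); split => //; first by apply: h1; exact: leq_maxl.
  by have := h2 (maxn N1 N2) (leq_maxr _ _); move/ltr_normlP => [_ /ltW].
(* All the approximants at once: the same colouring must serve every [i]. *)
pose q t := mkseq (fun i => s (inord i) t) n.+1.
have fq : fsimple q by apply: (fsimple_mkseq (q := fun i => s (inord i))) => i; have [] := hs (inord i).
have [c [fc cn hc]] := equal_joint_coloring n L fq.
exists c; split=> // i.
pose Ei := c @^-1` [set (i : nat)].
have mE : measurable Ei by exact: fsimple_preimage.
have mDE : measurable (D `&` Ei) by exact: measurableI.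
have fDE : finite_domain (D `&` Ei).
  by apply: finite_domainS fD => //; exact: subIsetl.
have [si di de] := hs i.
have fi := bochner_rintegrable fD (fv i).
have [sf _] := fv i.
have [u /(bochner_weak fDE) fu] := bochner_exists fDE
  (sm_sub (@subIsetl _ D Ei) sf) (rintegrableS mD mDE (@subIsetl _ D Ei) fi).
exists (n.+1%:R%:C *: u).
  have := weak_integral_restrict mD mE (weak_integralZ n.+1%:R mDE fu).
  apply: weak_integral_eq => // t _; congr (if _ then _ else _).
  by apply/idP/eqP => [/set_mem//|h]; apply/mem_set.
pose w := simple_integral (D `&` Ei) (s i).
have ws : weak_integral (D `&` Ei) (s i) w by exact: weak_integral_simple.
pose W := simple_integral D (s i).
have Ws : weak_integral D (s i) W by exact: weak_integral_simple.
(* Exact for the approximants: each level set of [q] has the fraction [1 / (n + 1)] of its measure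
   in colour [i]. *)
have wW : n.+1%:R%:C *: w = W.
  apply: rinner_inj => z; rewrite rinnerZl (ws z).2 (Ws z).2.
  pose g (x : seq H) := rinner (nth 0 x i) z.
  have gs t : g (q t) = rinner (s i t) z.
    by rewrite /g /q nth_mkseq// inord_val.
  rewrite -(rintegral_eq (fun t _ => gs t)) -[RHS](rintegral_eq (fun t _ => gs t)).
  have [_ h1] := rintegral_fsimple g mD fD.2 fq.
  have [_ h2] := rintegral_fsimple g mDE fDE.2 fq.
  rewrite [rintegral (D `&` Ei) _]h2 [rintegral D _]h1 !fsbig_finite//=; [|exact: fq.1..].
  rewrite mulr_sumr; apply: eq_bigr => x _.
  rewrite hc; last by rewrite -ltnS.
  by rewrite mulrCA [_ / _]mulrC mulVKf// pnatr_eq0.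
have -> : n.+1%:R%:C *: u - v i = n.+1%:R%:C *: (u - w) - (v i - W).
  by rewrite scalerBr wW opprB addrA subrK.
apply: le_trans (rnormB _ _) _; rewrite rnormZr normr_nat.
set I := rintegral D _ in de.
have b1 : rnorm (u - w) <= I.
  apply: le_trans (weak_integral_norm mDE (weak_integralB mDE fu ws)
    (rintegrableS mD mDE (@subIsetl _ D Ei) di) _) _ => //.
  have [k1 k2] := rintegral_restrict mD mE (rintegrableS mD mDE (@subIsetl _ D Ei) di).
  rewrite -k2; apply: rintegral_le => // t _.
  by case: ifP => // _; exact: rnorm_ge0.
have b2 : rnorm (v i - W) <= I.
  exact: (weak_integral_norm mD (weak_integralB mD (bochner_weak fD (fv i)) Ws) di).
apply: (@le_trans _ _ (n.+2%:R * I)).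
  rewrite -[n.+2]addn1 natrD mulrDl mul1r lerD// ler_wpM2l//.
by rewrite mulrC -ler_pdivlMr.
Qed.

End Chattering.

(** * Analytic semigroups *)

Section AnalyticSemigroup.
Import HBNNSimple.
Variables (R : realType) (H : hilbertType R) (A : ddop H) (S : R -> H -> H).
Hypothesis A_gen : generates_analytic (dom A) (fun x => - A x) S.
Implicit Types (s t r : R) (x y : H).

Let S_gen : generates (dom A) (fun x => - A x) S := A_gen.1.
Let S_C0 : C0_semigroup S := S_gen.1.

Lemma semigroup_bounded t : 0 <= t -> bounded_op (S t).
Proof. by case: S_C0 => h _ _ _; exact: h. Qed.

Lemma semigroup_linear t : 0 <= t -> linear (S t).
Proof. by move=> /semigroup_bounded[]. Qed.

Lemma semigroup0 x : S 0 x = x.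
Proof. by case: S_C0 => _ h _ _; exact: h. Qed.

Lemma semigroupD s t x : 0 <= s -> 0 <= t -> S (s + t) x = S s (S t x).
Proof. by case: S_C0 => _ _ h _ s0 t0; exact: h. Qed.

(** The complex derivative restricted to the real axis. It is a derivative in operator norm, uniform
    in [x], which a C0-semigroup need not have. *)
Lemma semigroup_derivable t : 0 < t -> exists2 S' : H -> H, bounded_op S' &
  forall e, 0 < e -> exists2 d, 0 < d & forall h, h != 0 -> `|h| < d -> forall x,
    0 <= t + h ->
    rnorm ((h^-1)%:C *: (S (t + h) x - S t x) - S' x) <= e * rnorm x.
Proof.
move=> t0; have [_ [theta [Sc [/andP[th0 thpi] [ScS _ _ Scd _]]]]] := A_gen.
(* Puts the positive reals inside the sector. *)
have tan0 : 0 < tan theta.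
  apply: divr_gt0.
    apply: sin_gt0_pi; rewrite th0 (lt_trans thpi)//.
    by rewrite gtr_pMr ?pi_gt0// invf_lt1// ltr1n.
  by apply: cos_gt0_pihalf; rewrite thpi andbT (lt_trans _ th0)// oppr_lt0 divr_gt0 ?pi_gt0.
have [|S' [S'b S'd]] := Scd t%:C.
  by split=> //=; rewrite normr0 mulr_gt0.
exists S' => // e /S'd /nbhs_ballP[d/= d0 hd].
have dr : d = (complex.Re d)%:C by rewrite RRe_real// gtr0_real.
exists (complex.Re d) => [|h h0 hd' x th]; first by rewrite -ltcR -dr.
have := hd h%:C; rewrite -ball_normE/= sub0r normrN.
have -> : `|h%:C| = `|h|%:C by rewrite normc_def/= expr0n addr0 sqrtr_sqr.
rewrite dr ltcR => /(_ hd').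
have -> : (h%:C != 0) by rewrite -[0]/(0%:C) (inj_eq (@complexI R)).
move=> /(_ isT x).
by rewrite -rmorphD/= -fmorphV !ScS//= ?(ltW t0)// !rnormE -rmorphM/= lecR.
Qed.

(** Near [t] the difference quotients are bounded in operator norm by [M + 1]. Norm continuity is
    what makes the integrands of Duhamel's formula strongly measurable. *)
Lemma semigroup_norm_continuous t : 0 < t -> forall e, 0 < e ->
  exists2 d, 0 < d & forall s, `|s - t| < d ->
    forall x, 0 <= s -> rnorm (S s x - S t x) <= e * rnorm x.
Proof.
move=> t0 e e0; have [S' S'b S'd] := semigroup_derivable t0.
have [M M0 S'M] := bounded_op_norm S'b.
have [d d0 hd] := S'd 1 ltr01.
have M1 : 0 < M + 1 by rewrite ltr_wpDl.
exists (Num.min d (e / (M + 1))) => [|s].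
  by rewrite lt_min d0 divr_gt0.
rewrite lt_min => /andP[sd se] x s0.
have [->|st] := eqVneq s t; first by rewrite subrr rnorm0 mulr_ge0 ?rnorm_ge0 ?ltW.
have h0 : s - t != 0 by rewrite subr_eq0.
have := hd _ h0 sd x; rewrite subrKC => /(_ s0); rewrite mul1r => h.
have {}h : rnorm (((s - t)^-1)%:C *: (S s x - S t x)) <= (M + 1) * rnorm x.
  rewrite -[X in rnorm X](subrK (S' x)) (le_trans (rnormD _ _))//.
  by rewrite mulrDl mul1r addrC lerD.
move: h; rewrite rnormZr normfV ler_pdivrMl ?normr_gt0// mulrA => /le_trans; apply.
by rewrite ler_wpM2r ?rnorm_ge0// -ler_pdivlMr// ltW.
Qed.

Lemma semigroup_generator x y : dom A x /\ - A x = y <->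
  (t^-1)%:C *: (S t x - x) @[t --> 0^'+] --> y.
Proof. exact: S_gen.2. Qed.

(** The right difference quotient of the semigroup at time [t] is the quotient at time 0 on the
    vector [S t x], so the derivative at [t] is the generator applied to [S t x]. *)
Lemma semigroup_smoothing t : 0 < t ->
  (forall x, dom A (S t x)) /\
  exists2 M, 0 <= M & forall x, rnorm (A (S t x)) <= M * rnorm x.
Proof.
move=> t0; have [S' S'b S'd] := semigroup_derivable t0.
have h x : dom A (S t x) /\ - A (S t x) = S' x.
  apply/semigroup_generator/rcvgP => e e0.
  have x1 : 0 < rnorm x + 1 by rewrite ltr_wpDl ?rnorm_ge0.
  have [d d0 hd] := S'd _ (divr_gt0 e0 x1).
  have := @nbhs_right_lt R 0 _ d0; apply: filterS2 (nbhs_right_gt 0) => r r0 rd.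
  rewrite -semigroupD ?ltW// [r + t]addrC.
  have := hd r; rewrite gt_eqF// gtr0_norm// => /(_ isT rd x) h.
  rewrite (le_lt_trans (h _))// ?addr_ge0 ?ltW//.
  by rewrite mulrAC ltr_pdivrMr// ltr_pM2l// ltrDl.
split=> [x|]; first exact: (h x).1.
have [M M0 S'M] := bounded_op_norm S'b; exists M => // x.
by rewrite -rnormN (h x).2.
Qed.

Lemma semigroup_commute t x : 0 <= t -> dom A x ->
  dom A (S t x) /\ A (S t x) = S t (A x).
Proof.
move=> t0 Dx; have Stb := semigroup_bounded t0; have [Stl Stc] := Stb.
have [h1 _] := semigroup_generator x (- A x).
have : (r^-1)%:C *: (S r (S t x) - S t x) @[r --> 0^'+] --> S t (- A x).
  have /(continuous_cvg _ (Stc _)) := h1 (conj Dx erefl).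
  apply: cvg_trans; apply: near_eq_cvg.
  apply: filterS (nbhs_right_gt 0) => r r0.
  rewrite /= op_linZ// op_linB//; congr (_ *: (_ - _)).
  by rewrite -!semigroupD ?(ltW r0)// addrC.
move=> /semigroup_generator[D1 e]; split=> //.
by apply: oppr_inj; rewrite e op_linN.
Qed.

(** Near 0, by contradiction: norms blowing up along times [t_ n] tending to 0 would violate uniform
    boundedness, since every orbit converges there. The semigroup law extends the bound by steps of
    length [d]. *)
Lemma semigroup_bound T : exists2 M, 0 <= M &
  forall t x, 0 <= t <= T -> rnorm (S t x) <= M * rnorm x.
Proof.
have [d d0 [K K1 hK]] : exists2 d, 0 < d & exists2 K, 1 <= K &
    forall t x, 0 <= t <= d -> rnorm (S t x) <= K * rnorm x.
  apply: contrapT => nb.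
  have /choice[t_ ht] (n : nat) : exists t, 0 <= t <= n.+1%:R^-1 /\
      exists x, n.+1%:R * rnorm x < rnorm (S t x).
    apply: contrapT => /forallNP h; apply: nb.
    exists (n.+1%:R^-1); first by rewrite invr_gt0.
    exists n.+1%:R; first by rewrite ler1n.
    move=> t x t0; rewrite leNgt; apply/negP => hx.
    by apply: (h t); split => //; exists x.
  have t0 n : 0 <= t_ n by have [/andP[]] := ht n.
  have t_cvg0 : t_ n @[n --> \oo] --> 0.
    apply: (@squeeze_cvgr _ _ _ _ (cst 0) (@harmonic R)); last exact: cvg_harmonic.
      by apply: nearW => n /=; have [] := ht n.
    exact: cvg_cst.
  have [||x|K hK] := @uniform_boundedness _ H H (fun n => S (t_ n)).
  - by move=> n; exact: semigroup_linear.
  - by move=> n; apply: bounded_op_norm; exact: semigroup_bounded.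
  - have /rcvgP/(_ 1 ltr01) : S t x @[t --> 0^'+] --> x by case: S_C0 => _ _ _; exact.
    move=> /nbhs_ballP[d/= d0 hd].
    move/cvgrPdist_lt : t_cvg0 => /(_ d d0)[N _ hN].
    have tail n : (N <= n)%N -> rnorm (S (t_ n) x) <= rnorm x + 1.
      (* The filter at [0^'+] says nothing about the time 0 itself. *)
      move=> Nn; have [->|tn0] := eqVneq (t_ n) 0.
        by rewrite semigroup0 lerDl.
      have := hd (t_ n) (hN n Nn); rewrite lt_def tn0 t0 => /(_ isT) h.
      have := rnormD (S (t_ n) x - x) x; rewrite subrK; lra.
    exists (rnorm x + 1 + \sum_(i < N) rnorm (S (t_ i) x)) => n.
    have [Nn|nN] := leqP N n.
      by rewrite (le_trans (tail n Nn))// lerDl sumr_ge0// => i _; exact: rnorm_ge0.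
    rewrite (bigD1 (Ordinal nN))//= addrCA lerDl.
    by rewrite !addr_ge0 ?rnorm_ge0// sumr_ge0// => i _; exact: rnorm_ge0.
  pose n := Num.truncn K.
  have [_ [x hx]] := ht n; have := hK n x; apply/negP; rewrite -ltNge.
  apply: le_lt_trans hx; rewrite ler_wpM2r ?rnorm_ge0// ltW//.
  exact: truncnS_gt.
have pow k t x : 0 <= t <= k%:R * d -> rnorm (S t x) <= K ^+ k * rnorm x.
  elim: k t => [|k ih] t.
    by rewrite mul0r => /le_anti <-; rewrite semigroup0 expr0 mul1r.
  move=> /andP[t0 tk]; have [td|td] := leP t d.
    apply: (le_trans (hK t x _)); first by rewrite t0.
    by rewrite ler_wpM2r ?rnorm_ge0// exprS ler_peMr ?(le_trans ler01)// exprn_ege1.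
  have td0 : 0 <= t - d by rewrite subr_ge0 ltW.
  rewrite -(subrK d t) addrC semigroupD ?(ltW d0)//.
  apply: (le_trans (hK d _ _)); first by rewrite ltW/=.
  rewrite exprS -mulrA ler_wpM2l ?(le_trans ler01)// ih// td0/=.
  by rewrite lerBlDr -[X in _ + X]mul1r -mulrDl natr1.
have [k Tk] : exists k : nat, T <= k%:R * d.
  exists (Num.truncn (T / d)).+1; rewrite -ler_pdivrMr// ltW//.
  exact: truncnS_gt.
exists (K ^+ k) => [|t x /andP[t0 tT]].
  by rewrite exprn_ge0// (le_trans ler01).
by apply: pow; rewrite t0 (le_trans tT).
Qed.

(** Time is approximated by simple functions [q_ n] as well. Since [t - s > 0], norm continuity
    controls the change of time uniformly over the bounded sequence [g_ n s]. *)
Lemma semigroup_sm (D : set R) t (g : R -> H) : measurable D ->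
  (forall s, D s -> 0 <= s < t) -> strongly_measurable D g ->
  strongly_measurable D (fun s => S (t - s) (g s)).
Proof.
move=> mI DI [g_ [fg gg]].
have mid : measurable_fun D (EFin \o @id R).
  by apply/measurable_EFinP; exact: measurable_id.
pose q_ := nnsfun_approx mI mid.
have q_cvg s : D s -> q_ n s @[n --> \oo] --> s.
  move=> st; have s0 r : D r -> (0 <= (EFin \o @id R) r)%E.
    by move=> /DI/andP[? _]; rewrite /= lee_fin.
  have /fine_cvgP[_] := cvg_nnsfun_approx mI mid s0 st.
  exact.
have fq n : fsimple (q_ n).
  by split=> [|v]; [exact: fimfunP|exact: measurable_sfunP].
exists (fun n s => S (t - q_ n s) (g_ n s)); split=> [n|s st].
  exact: (fsimple_comp (fun x : R * H => S (t - x.1) x.2) (fsimple_pair (fq n) (fg n))).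
have qs := q_cvg s st; have gs := gg s st.
have ts0 : 0 < t - s by have /andP[_] := DI _ st; rewrite subr_gt0.
have [M M0 hM] := bounded_op_norm (semigroup_bounded (ltW ts0)).
have Sl := semigroup_linear (ltW ts0).
apply/rcvgP => e e0.
pose e1 := e / (2 * (rnorm (g s) + 1)).
have g1 : 0 < rnorm (g s) + 1 by rewrite ltr_wpDl ?rnorm_ge0.
have e10 : 0 < e1 by rewrite divr_gt0// mulr_gt0.
have [d d0 hd] := semigroup_norm_continuous ts0 e10.
have M1 : 0 < 2 * (M + 1) by rewrite mulr_gt0// ltr_wpDl.
move/cvgrPdist_lt : qs => /(_ (Num.min d (t - s))).
rewrite lt_min d0 ts0 => /(_ isT) qs.
move/rcvgP : gs => gs; have gs1 := gs 1 ltr01; have gs2 := gs _ (divr_gt0 e0 M1).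
apply: filterS3 qs gs1 gs2 => n; rewrite lt_min => /andP[h1 h1'] h2 h3.
have -> : S (t - q_ n s) (g_ n s) - S (t - s) (g s) =
  (S (t - q_ n s) (g_ n s) - S (t - s) (g_ n s)) + S (t - s) (g_ n s - g s).
  by rewrite op_linB// addrA subrK.
apply: le_lt_trans (rnormD _ _) _.
have b1 : rnorm (S (t - q_ n s) (g_ n s) - S (t - s) (g_ n s)) <= e / 2.
  apply: (@le_trans _ _ (e1 * rnorm (g_ n s))).
    apply: hd; first by rewrite opprB addrC addrA subrK.
    by move: h1' => /ltr_normlP[]; lra.
  apply: (@le_trans _ _ (e1 * (rnorm (g s) + 1))).
    rewrite ler_wpM2l ?(ltW e10)//.
    have := rnormD (g_ n s - g s) (g s); rewrite subrK; lra.
  by rewrite /e1 invfM mulrA divfK ?gt_eqF.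
have b2 : rnorm (S (t - s) (g_ n s - g s)) < e / 2.
  apply: le_lt_trans (hM _) _.
  have : rnorm (g_ n s - g s) * (M + 1) < e / 2.
    by move: h3; rewrite ltr_pdivlMr// ltr_pdivlMr//; lra.
  have := rnorm_ge0 (g_ n s - g s); lra.
lra.
Qed.

End AnalyticSemigroup.

(** * The space D(A^* )' as a copy of H *)

(** Injectivity makes the level sets of [f \o s] those of [s], so the two sums match term by
    term. *)
Lemma simple_integral_map (R : realType) (V W : normedModType R[i])
    (f : V -> W) D (s : R -> V) : linear f -> injective f ->
  simple_function s -> simple_integral D (f \o s) = f (simple_integral D s).
Proof.
move=> fl fi fs; rewrite /simple_integral.
have fin := fs.1.
rewrite [RHS](_ : _ = f (\sum_(v <- finmap.enum_fset (fset_set (range s)))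
   (fine (lebesgue_measure (D `&` s @^-1` [set v])))%:C *: v)); last first.
  by rewrite fsbig_finite.
rewrite op_lin_sum//.
rewrite (@reindex_fsbig _ _ _ _ _ f (range s)); last first.
  split=> [_ [t _ <-]|x y _ _ /fi//|_ [t _ <-]]; first by exists t.
  by exists (s t) => //; exists t.
rewrite fsbig_finite//=; apply: eq_bigr => v _.
rewrite op_linZ//; congr ((fine (lebesgue_measure (D `&` _)))%:C *: _).
by apply/seteqP; split=> t /= [] => [/fi|->].
Qed.

Lemma bochner_integral_map (R : realType) (V W : normedModType R[i])
    (f : V -> W) D (g : R -> V) v : measurable D -> bounded_op f -> injective f ->
  bochner_integral D g v -> bochner_integral D (f \o g) (f v).
Proof.
move=> mD fb fi [sg [s_ [fs sg0 sv]]]; have [fl fc] := fb.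
split; first exact: sm_comp.
exists (fun n => f \o s_ n); split=> [n||].
- exact: (fsimple_comp f (fs n)).
- have [M M0 hM] := bounded_op_norm fb.
  have dsm n : strongly_measurable D (fun t => g t - s_ n t).
    by apply: smD => //; apply: smN; apply: sm_simple; exact: fs.
  have md n : measurable_fun D (fun t => (rnorm (g t - s_ n t))%:E).
    by apply/measurable_EFinP; exact: sm_rnorm.
  have up : (M%:E * \int[lebesgue_measure]_(t in D) (rnorm (g t - s_ n t))%:E)%E
      @[n --> \oo] --> 0%E.
    by rewrite -(mule0 M%:E); apply: cvgeZl.
  apply: (squeeze_cvge _ (@cvg_cst _ _ _ _ _) up); apply: nearW => n.
  apply/andP; split; first by apply: integral_ge0 => t _; rewrite lee_fin rnorm_ge0.
  have nd t : D t -> (0 <= (rnorm (g t - s_ n t))%:E)%E.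
    by move=> _; rewrite lee_fin rnorm_ge0.
  rewrite -(ge0_integralZl (@lebesgue_measure R) mD (md n) nd)//.
  apply: (@ge0_le_integral _ _ _ (@lebesgue_measure R)) => //.
  + by move=> t _; rewrite lee_fin rnorm_ge0.
  + have := dsm n => /(sm_comp fc) /sm_rnorm h; apply/measurable_EFinP.
    by apply: eq_measurable_fun h => t _ /=; rewrite op_linB.
  + by apply: measurable_funeM; exact: md.
  + by move=> t _; rewrite -EFinM lee_fin /= -op_linB.
- under eq_fun do rewrite simple_integral_map//.
  by apply: continuous_cvg => //; exact: fc.
Qed.

Lemma bochner_integral_eq (R : realType) (V : normedModType R[i])
    D (f g : R -> V) v : (forall t, D t -> f t = g t) ->
  bochner_integral D f v -> bochner_integral D g v.
Proof.
move=> fg [sf [s_ [fs sf0 sv]]]; split; first exact: sm_eq sf.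
exists s_; split=> //; move: sf0; apply: cvg_trans; apply: near_eq_cvg.
apply: nearW => n; apply: eq_integral => t /set_mem Dt.
by rewrite fg.
Qed.

Section DualIdentification.
Variables (R : realType) (H : hilbertType R) (A : ddop H) (mu : R[i]) (Q : H -> H).
Hypothesis AQ : resolvent_at A mu Q.
Implicit Types (x y h : H) (phi : domain_adj A) (f : dual_dom_adj A).

Let Qb : bounded_op Q. Proof. by case: AQ. Qed.
Let Ql : linear Q. Proof. by case: Qb. Qed.
Let QD y : dom A (Q y). Proof. by case: AQ => _ /(_ y)[]. Qed.
Let AQK y : mu *: Q y - A (Q y) = y. Proof. by case: AQ => _ /(_ y)[]. Qed.
Let QAK x : dom A x -> Q (mu *: x - A x) = x.
Proof. by case: AQ => _ _; exact. Qed.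

Lemma domain_adjP phi : adjoint_rel A phi (adj A phi).
Proof. by apply: adjP; case: phi => phi /= /asboolP. Qed.

Lemma adj_linear (a : R[i]) phi phi' :
  adj A (a *: phi + phi' : domain_adj A) = a *: adj A phi + adj A phi'.
Proof. by apply: adjE; apply: adjoint_rel_lin; exact: domain_adjP. Qed.

Lemma inner_resolvent x phi :
  inner (Q x) (Num.conj mu *: (phi : H) - adj A phi) = inner x (phi : H).
Proof.
rewrite linearBr/= linearZr_LR/= conjCK -domain_adjP// -linearZl_LR/=.
by rewrite -linearBl/= AQK.
Qed.

(** The Hilbert adjoint of [Q] is the resolvent of the adjoint of [A] at [conj mu]. As the adjoint
    of [A] maps [Qs y] to [conj mu Qs y - y], boundedness holds for the graph norm too. *)
Lemma adj_resolvent : exists2 Qd : H -> domain_adj A, bounded_op Qd &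
  (forall y, Num.conj mu *: (Qd y : H) - adj A (Qd y) = y) /\
  (forall phi, Qd (Num.conj mu *: (phi : H) - adj A phi) = phi).
Proof.
have [Qs Qsb QQs] := adjoint_exists Qb.
have rel y : adjoint_rel A (Qs y) (Num.conj mu *: Qs y - y).
  move=> x Dx; rewrite -QQs.
  have -> : Q (A x) = mu *: Q x - x.
    by rewrite -[X in _ - X](QAK Dx) op_linB// op_linZ// subKr.
  by rewrite linearBl/= linearZl_LR/= linearBr/= linearZr_LR/= conjCK QQs.
have Qsd y : Qs y \in @dom_adj_pred R H A.
  by apply/asboolP; eexists; exact: rel.
pose Qd y : domain_adj A := DomainAdj (Qsd y).
have adjQd y : adj A (Qd y) = Num.conj mu *: Qs y - y by apply: adjE; exact: rel.
exists Qd.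
  apply: norm_bounded_op.
    by move=> a x y; apply: val_inj => /=; rewrite (Qsb.1).
  have [M M0 hM] := bounded_op_norm Qsb.
  exists (M + (complex.Re `|Num.conj mu| * M + 1)) => [|y].
    by rewrite !addr_ge0// mulr_ge0// -lecR RRe_real ?normr_real ?normr_ge0.
  have -> : rnorm (Qd y) = rnorm (Qs y) + rnorm (adj A (Qd y)).
    apply: (@complexI R); rewrite -rnormE rmorphD/= -!rnormE; exact: erefl.
  rewrite adjQd.
  rewrite mulrDl lerD// (le_trans (rnormB _ _))// mulrDl mul1r lerD//.
  rewrite rnormZ -mulrA ler_wpM2l//.
  by rewrite -lecR RRe_real ?normr_real ?normr_ge0.
split=> [y|phi]; first by rewrite adjQd subKr.
apply: val_inj => /=; apply: rinner_inj => z; rewrite /rinner inner_conj -QQs.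
by rewrite inner_resolvent -inner_conj.
Qed.

Fact dual_embedding_subproof h :
  (fun phi : domain_adj A => inner h (Num.conj mu *: (phi : H) - adj A phi)) \in
  @bounded_antilinear_pred R (domain_adj A).
Proof.
apply/asboolP; split=> [a u v|].
  rewrite adj_linear /= scalerDr opprD addrACA.
  by rewrite scalerA mulrC -scalerA -scalerBr linearDr/= linearZr_LR.
exists (rnorm h * (complex.Re `|Num.conj mu| + 1)) => phi.
apply: le_trans (norm_inner_le _ _) _.
rewrite !rnormE -!rmorphM lecR/= -mulrA ler_wpM2l ?rnorm_ge0//.
apply: le_trans (rnormB _ _) _.
have -> : rnorm phi = rnorm (phi : H) + rnorm (adj A phi).
  apply: (@complexI R); rewrite -rnormE rmorphD/= -!rnormE; exact: erefl.
have n0 : 0 <= complex.Re `|Num.conj mu|.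
  by rewrite -lecR RRe_real ?normr_real ?normr_ge0.
rewrite rnormZ mulrDl mul1r lerD// ?ler_wpM2l ?lerDl ?lerDr ?rnorm_ge0//.
Qed.

(* Extends to all of [H] the map [h |-> pivot A (mu *: h - A h)] on [dom A]. *)
Definition dual_embedding h : dual_dom_adj A :=
  Antidual (dual_embedding_subproof h).

Local Notation J := dual_embedding.

Lemma dual_embedding_bounded : bounded_op J.
Proof.
apply: norm_bounded_op.
  move=> a x y; apply: val_inj; apply/funext => phi /=.
  by rewrite linearDl/= linearZl_LR.
have n0 : 0 <= complex.Re `|Num.conj mu|.
  by rewrite -lecR RRe_real ?normr_real ?normr_ge0.
exists (complex.Re `|Num.conj mu| + 1) => [|h]; first by rewrite addr_ge0.
rewrite rnorm_le_C; apply: antidual_norm_le.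
  by rewrite mulr_ge0 ?addr_ge0 ?rnorm_ge0.
move=> phi; apply: le_trans (norm_inner_le _ _) _.
rewrite !rnormE -!rmorphM lecR/= [(_ + 1) * _]mulrC -mulrA ler_wpM2l ?rnorm_ge0//.
apply: le_trans (rnormB _ _) _.
have -> : rnorm phi = rnorm (phi : H) + rnorm (adj A phi).
  apply: (@complexI R); rewrite -rnormE rmorphD/= -!rnormE; exact: erefl.
by rewrite rnormZ mulrDl mul1r lerD// ?ler_wpM2l ?lerDl ?lerDr ?rnorm_ge0.
Qed.

(** Composing [f] with [Qd] gives a continuous antilinear functional on [H], and [K f] is its Riesz
    vector. The bound comes from [f (Qd (K f)) = |K f|^2]. *)
Lemma dual_embedding_inverse : exists2 K : dual_dom_adj A -> H, bounded_op K &
  cancel J K /\ cancel K J.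
Proof.
have [Qd Qdb [QdK QdK']] := adj_resolvent; have [Qdl _] := Qdb.
have [M M0 hM] := bounded_op_norm Qdb.
have Qdf f y : `|f (Qd y)| <= (rnorm f * M)%:C * `|y|.
  apply: le_trans (antidual_normP f (Qd y)) _.
  rewrite -[antidual_norm f]/(`|f|) !rnormE -!rmorphM lecR/= -mulrA.
  by rewrite ler_wpM2l ?rnorm_ge0.
have /choice[K hK] f : exists h, forall y, f (Qd y) = inner h y.
  apply: riesz; split=> [a u v|]; last by exists (rnorm f * M); exact: Qdf.
  by rewrite Qdl; have [fl _] := antidualP f; rewrite fl.
have JK : cancel J K.
  move=> h; apply: rinner_inj => y; rewrite /rinner -hK /= QdK.
  by [].
have KJ : cancel K J.
  by move=> f; apply: val_inj; apply/funext => phi /=; rewrite -hK QdK'.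
exists K => //; apply: norm_bounded_op.
  move=> a f g; apply: (can_inj JK); rewrite KJ.
  by have [Jl _] := dual_embedding_bounded; rewrite Jl !KJ.
exists M => // f; have [->|kf0] := eqVneq (K f) 0.
  by rewrite rnorm0 mulr_ge0 ?rnorm_ge0.
have nk : 0 < rnorm (K f) by rewrite lt_def rnorm_eq0 kf0 rnorm_ge0.
rewrite -(ler_pM2r nk) -expr2.
have := Qdf f (K f); rewrite hK inner_norm rnormE -!rmorphXn -rmorphM/=.
have -> : `|(rnorm (K f) ^+ 2)%:C| = (rnorm (K f) ^+ 2)%:C.
  by rewrite ger0_norm// lecR sqr_ge0.
by rewrite lecR [M * _]mulrC.
Qed.

Lemma pivotE h : pivot A h = J (Q h).
Proof.
by apply: val_inj; apply/funext => phi /=; rewrite inner_resolvent.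
Qed.

(** On the domain of [A], [J x] is the pivot image of [mu x - A x] and [S t] commutes with [A]; both
    sides are bounded in [h] and the domain is dense. *)
Lemma dual_embedding_semigroup (S : R -> H -> H) Sext t h :
  generates_analytic (dom A) (fun x => - A x) S ->
  extends_semigroup S Sext -> 0 <= t -> Sext t (J h) = J (S t h).
Proof.
move=> S_gen S_ext t0; have [Sextb SextE] := S_ext t t0.
have Stb := semigroup_bounded S_gen t0.
have domE x : dom A x -> Sext t (J x) = J (S t x).
  move=> Dx; have [DSx ASx] := semigroup_commute S_gen t0 Dx.
  rewrite -{1}(QAK Dx) -pivotE SextE -(QAK DSx) -pivotE ASx.
  by rewrite op_linB ?op_linZ//; case: Stb.
have [M1 M10 h1] := bounded_op_norm (bounded_op_comp dual_embedding_bounded Sextb).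
have [M2 M20 h2] := bounded_op_norm (bounded_op_comp Stb dual_embedding_bounded).
have l1 := (bounded_op_comp dual_embedding_bounded Sextb).1.
have l2 := (bounded_op_comp Stb dual_embedding_bounded).1.
apply/eqP; rewrite -subr_eq0 -rnorm_eq0; apply/negPn/negP => d0.
set d := rnorm _ in d0.
have dpos : 0 < d by rewrite lt_def d0 rnorm_ge0.
pose e := d / (M1 + M2 + 1).
have m0 : 0 < M1 + M2 + 1 by rewrite ltr_wpDl ?addr_ge0.
have e0 : 0 < e by rewrite divr_gt0.
have e0' : 0 < e%:C by rewrite ltcR.
have [x [xd Dx]] : ball h e%:C `&` dom A !=set0.
  apply: (dom_dense A); first by exists h; exact: ballxx.
  exact: ball_open.
move: xd; rewrite -ball_normE/= rnormE ltcR => xd.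
have : d <= (M1 + M2) * rnorm (h - x).
  rewrite /d.
  have -> : Sext t (J h) - J (S t h) =
     (Sext t \o J) (h - x) - (J \o S t) (h - x).
    by rewrite (op_linB _ _ l1) (op_linB _ _ l2) /= (domE x Dx) opprB addrA subrK.
  by rewrite (le_trans (rnormB _ _))// mulrDl lerD.
move: xd; rewrite /e ltr_pdivlMr//; have := rnorm_ge0 (h - x); nra.
Qed.

End DualIdentification.

(** * Square-integrable functions *)

Section SquareIntegrable.
Variables (R : realType).
Local Notation mu := (@lebesgue_measure R).
Implicit Types (V W : normedModType R[i]) (D E : set R).

Lemma sm_shift V D (f : R -> V) (a : R) : strongly_measurable D f ->
  strongly_measurable ((fun t => t + a) @^-1` D) (fun t => f (t + a)).
Proof.
move=> [s_ [fs sf]]; exists (fun n t => s_ n (t + a)); split=> [n|t Dt].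
  split=> [|v]; last exact: (measurable_shift a ((fs n).2 v)).
  by apply: sub_finite_set (fs n).1 => _ [t _ <-]; exists (t + a).
exact: sf.
Qed.

(** The [n]-th approximant glues those of the first [n] pieces only, which keeps its range finite;
    by disjointness a point of [D_ k] sees [s_ k n] once [n > k]. *)
Lemma sm_bigcup V (D_ : nat -> set R) (f : R -> V) :
  (forall k, measurable (D_ k)) -> trivIset setT D_ ->
  (forall k, strongly_measurable (D_ k) f) ->
  strongly_measurable (\bigcup_k D_ k) f.
Proof.
move=> mD tD /choice[s_ hs].
pose r n := fix r m t := if m is m'.+1 then
  (if t \in D_ m' then s_ m' n t else r m' t) else 0.
exists (fun n => r n n); split=> [n|t [k _ Dkt]].
  suff h m : fsimple (r n m) by exact: h.
  elim: m => [|m ih]; first exact: fsimple_cst.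
  by apply: fsimple_if => //; have [fs _] := hs m; exact: fs.
have [_ /(_ t Dkt) cv] := hs k.
apply: cvg_trans cv; apply: near_eq_cvg; exists k.+1 => // n /= kn.
have h m : (k < m)%N -> r n m t = s_ k n t.
  elim: m => //= m ih; rewrite ltnS leq_eqVlt => /predU1P[<-|km].
    by rewrite mem_set.
  rewrite memNset ?ih// => Dmt; move: km.
  by rewrite (tD m k)// ?ltnn//; exists t.
by rewrite h.
Qed.

(** The squared L2 norm on any set: additive over disjoint sets, hence suited to controls glued from
    infinitely many intervals. *)
Definition energy V D (u : R -> V) : \bar R :=
  (\int[mu]_(t in D) (rnorm (u t) ^+ 2)%:E)%E.

Lemma L2normE V (T : R) (u : R -> V) :
  (L2norm T u `^ 2)%E = energy `]0, T[ u.
Proof.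
rewrite /L2norm poweR_Lnorm ?pnatr_eq0// /energy [RHS]integral_mkcond.
apply: eq_integral => t _; rewrite !patchE; case: ifP => _.
  rewrite /= -powR_mulrn ?rnorm_ge0// ger0_norm ?rnorm_ge0//.
by rewrite /= normr0 powR0// pnatr_eq0.
Qed.


Lemma L2norm_lty V (T : R) (u : R -> V) :
  (L2norm T u < +oo)%E <-> (energy `]0%R, T[ u < +oo)%E.
Proof.
rewrite -L2normE; split=> [|/lty_poweRy]; first exact: poweR_lty.
by apply; rewrite pnatr_eq0.
Qed.

Lemma L2norm_le V (T c : R) (u : R -> V) : (L2norm T u <= c%:E)%E ->
  (energy `]0%R, T[ u <= (c ^+ 2)%:E)%E.
Proof.
move=> h; have L0 : (0 <= L2norm T u)%E by exact: Lnorm_ge0.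
have c0 : 0 <= c by rewrite -lee_fin (le_trans L0).
rewrite -L2normE -powR_mulrn// -poweR_EFin.
by apply: gt0_ler_poweR; rewrite ?in_itv/= ?leey ?L0 ?lee_fin ?c0.
Qed.

Lemma measurable_sqr_rnorm V D (u : R -> V) : strongly_measurable D u ->
  measurable_fun D (fun t => (rnorm (u t) ^+ 2)%:E).
Proof.
by move=> /sm_rnorm mu_; apply/measurable_EFinP; exact: measurable_funX.
Qed.

Lemma energyS V D E (u : R -> V) : measurable D -> measurable E -> D `<=` E ->
  strongly_measurable E u -> (energy D u <= energy E u)%E.
Proof.
move=> mD mE DE uE; apply: (@ge0_subset_integral _ _ _ mu) => //.
  exact: measurable_sqr_rnorm.
by move=> t _; rewrite lee_fin sqr_ge0.
Qed.

Lemma energy_le V W D (u : R -> V) (v : R -> W) (c : R) : measurable D -> 0 <= c ->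
  strongly_measurable D u -> strongly_measurable D v ->
  (forall t, D t -> rnorm (v t) <= c * rnorm (u t)) ->
  (energy D v <= (c ^+ 2)%:E * energy D u)%E.
Proof.
move=> mD c0 su sv h.
have nu t : D t -> (0 <= (rnorm (u t) ^+ 2)%:E)%E by rewrite lee_fin sqr_ge0.
rewrite /energy -(ge0_integralZl mu mD (measurable_sqr_rnorm su) nu) ?lee_fin ?sqr_ge0//.
apply: (@ge0_le_integral _ _ _ mu) => //.
- by move=> t _; rewrite lee_fin sqr_ge0.
- exact: measurable_sqr_rnorm.
- by apply: measurable_funeM; exact: measurable_sqr_rnorm.
- move=> t Dt; rewrite -EFinM lee_fin -exprMn ler_sqr ?nnegrE ?mulr_ge0 ?rnorm_ge0//.
  exact: h.
Qed.

(** [a <= 1 + a ^+ 2], on a set of finite measure. *)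
Lemma energy_rintegrable V D (u : R -> V) : finite_domain D ->
  strongly_measurable D u -> (energy D u < +oo)%E ->
  rintegrable D (fun t => rnorm (u t)).
Proof.
move=> [mD Doo] su eu.
have sq : rintegrable D (fun t => rnorm (u t) ^+ 2).
  apply/integrableP; split; first exact: measurable_sqr_rnorm.
  apply: le_lt_trans eu; rewrite le_eqVlt; apply/orP; left; apply/eqP.
  by apply: eq_integral => t _ /=; rewrite ger0_norm// sqr_ge0.
apply: rintegrable_le (rintegrableD mD (rintegrable_cst 1 mD Doo) sq) => //.
  exact: sm_rnorm.
move=> t _; rewrite ger0_norm ?rnorm_ge0//; have := rnorm_ge0 (u t); nra.
Qed.

Lemma energy_shift V D (u : R -> V) (a : R) : measurable D ->
  strongly_measurable D u ->
  energy ((fun t => t + a) @^-1` D) (fun t => u (t + a)) = energy D u.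
Proof.
move=> mD su; apply: (@ge0_integral_shift _ a D (fun t => rnorm (u t) ^+ 2)) => //.
  by apply: measurable_funX; exact: sm_rnorm.
by move=> t _; exact: sqr_ge0.
Qed.

Lemma energy_eq V D (u v : R -> V) : (forall t, D t -> u t = v t) ->
  energy D u = energy D v.
Proof. by move=> uv; apply: eq_integral => t /set_mem Dt; rewrite uv. Qed.

Lemma energy_restrict V D E (u : R -> V) :
  energy D (fun t => if t \in E then u t else 0) = energy (D `&` E) u.
Proof.
rewrite /energy integral_mkcondr; apply: eq_integral => t _.
by rewrite patchE; case: ifP => // _; rewrite rnorm0 expr0n.
Qed.

End SquareIntegrable.

(** * Switching null controls *)

Section SwitchingStep.
Variables (R : realType) (H : hilbertType R) (A : ddop H) (S : R -> H -> H).
Hypothesis A_gen : generates_analytic (dom A) (fun x => - A x) S.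
Variables (mu : R[i]) (Q : H -> H).
Hypothesis AQ : resolvent_at A mu Q.
Variables (n : nat) (U_ : 'I_n.+1 -> hilbertType R) (b : forall i, U_ i -> H).
Hypothesis b_bounded : forall i, bounded_op (@b i).
Implicit Types (y : H) (u g : forall i, R -> U_ i) (D : set R).

Let Sl t (t0 : 0 <= t) : linear (S t) := semigroup_linear A_gen t0.

Lemma resolvent_bounded : bounded_op Q. Proof. by case: AQ. Qed.

(** The integrand of Duhamel's formula at time [t], in the copy of [H]. *)
Definition flow (u : forall i, R -> U_ i) (t s : R) : H :=
  \sum_i S (t - s) (b (u i s)).

Lemma flow_term_sm D t i (v : R -> U_ i) : measurable D ->
  (forall s, D s -> 0 <= s < t) -> strongly_measurable D v ->
  strongly_measurable D (fun s => S (t - s) (b (v s))).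
Proof.
move=> mD DI sv; apply: (semigroup_sm A_gen mD DI (g := fun s => b (v s))).
have [_ bc] := b_bounded i; exact: (sm_comp bc sv).
Qed.

Lemma flow_term_integrable D t i (v : R -> U_ i) : finite_domain D ->
  (forall s, D s -> 0 <= s < t) -> strongly_measurable D v ->
  (energy D v < +oo)%E ->
  rintegrable D (fun s => rnorm (S (t - s) (b (v s)))).
Proof.
move=> fD DI sv ev; have [mD _] := fD.
have vi := energy_rintegrable fD sv ev.
have [M M0 hM] := semigroup_bound A_gen t.
have [K K0 hK] := bounded_op_norm (b_bounded i).
apply: rintegrable_le (rintegrableZ (M * K) mD vi) => //.
  by apply: sm_rnorm; exact: flow_term_sm.
move=> s /DI/andP[s0 st]; rewrite ger0_norm ?rnorm_ge0//.
apply: (le_trans (hM _ _ _)); first by rewrite subr_ge0 ltW//= lerBlDr lerDl.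
by rewrite -mulrA ler_wpM2l.
Qed.

Lemma flow_sm D t u : measurable D -> (forall s, D s -> 0 <= s < t) ->
  (forall i, strongly_measurable D (u i)) -> strongly_measurable D (flow u t).
Proof. by move=> mD DI su; apply: sm_sum => i; exact: flow_term_sm. Qed.

Lemma flow_integrable D t u : finite_domain D ->
  (forall s, D s -> 0 <= s < t) -> (forall i, strongly_measurable D (u i)) ->
  (forall i, energy D (u i) < +oo)%E ->
  rintegrable D (fun s => rnorm (flow u t s)).
Proof.
move=> fD DI su eu; have [mD _] := fD.
have ti i := flow_term_integrable fD DI (su i) (eu i).
apply: rintegrable_le (rintegrable_sum (index_enum _) mD ti) => //.
  by apply: sm_rnorm; exact: flow_sm.
by move=> s _; rewrite ger0_norm ?rnorm_ge0// rnorm_sum.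
Qed.

(** Null controllability in the copy of [H], where the initial state [y] is represented by [Q y]. *)
Definition null_controllable := forall T, 0 < T -> exists2 C, 0 <= C &
  forall y, exists u : forall i, R -> U_ i,
    [/\ forall i, strongly_measurable `]0, T[ (u i),
        forall i, (energy `]0%R, T[ (u i) <= ((C * rnorm y) ^+ 2)%:E)%E &
        weak_integral `]0, T[ (flow u T) (- S T (Q y))].

Definition switching (g : forall i, R -> U_ i) :=
  forall t, exists i0, forall j, j != i0 -> g j t = 0.

(** By Duhamel's formula the last clause says that [g] steers [y] to [y'] in time [L]. The order of
    quantifiers matters: the cost [C] is fixed before the tolerance [e]. *)
Lemma switching_step : null_controllable -> forall L, 0 < L -> exists2 C, 0 <= C &
  forall y e, 0 < e -> exists g : forall i, R -> U_ i, exists y',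
    [/\ forall i, strongly_measurable setT (g i), switching g /\ (forall i t, t <= 0 -> g i t = 0),
        forall i, (energy setT (g i) <= ((C * rnorm y) ^+ 2)%:E)%E,
        rnorm y' <= e &
        weak_integral `[0, L[ (flow g L) (Q y' - S L (Q y))].
Proof.
move=> nc L L0; pose t1 := L / 2; have t10 : 0 < t1 by rewrite divr_gt0.
have Lt : L = t1 + t1 := splitr L.
have [C C0 hC] := nc _ t10.
exists (n.+1%:R * C) => [|y e e0]; first by rewrite mulr_ge0.
have [u [su eu uy]] := hC y.
pose D : set R := `]0, t1[%classic.
have fD : finite_domain D by exact: finite_domain_itv.
have mD := fD.1.
have DI s : D s -> 0 <= s < t1 by rewrite /D/= in_itv/= => /andP[/ltW -> ->].
have eu_oo i : (energy D (u i) < +oo)%E by apply: le_lt_trans (eu i) (ltry _).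
pose f i s := S (t1 - s) (b (u i s)).
have /choice[v hv] i := bochner_exists fD (flow_term_sm mD DI (su i))
  (flow_term_integrable fD DI (su i) (eu_oo i)).
have wv i := bochner_weak fD (hv i).
have sumv : \sum_i v i = - S t1 (Q y).
  exact: weak_integral_uniq (weak_integral_sum (index_enum _) mD wv) uy.
have [domS [MA MA0 hMA]] := semigroup_smoothing A_gen t10.
have [M M0 hM] := bounded_op_norm (semigroup_bounded A_gen (ltW t10)).
pose m := complex.Re `|mu|.
have m0 : 0 <= m by rewrite -lecR RRe_real ?normr_real ?normr_ge0.
(* A bound for the operator [(mu - A) S t1], which maps the defect [d] to [y']; the tolerance is
   divided by [G + 1] and shared among the [n + 1] components. *)
pose G := m * M + MA; have G0 : 0 <= G by rewrite addr_ge0 ?mulr_ge0.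
have nG : 0 < n.+1%:R * (G + 1) by rewrite mulr_gt0// ltr_wpDl.
have [c [fc cn hc]] := chattering (divr_gt0 e0 nG) hv.
have /choice[v' hv'] (i : 'I_n.+1) : exists v'i, weak_integral D
    (fun t => if c t == i then n.+1%:R%:C *: f i t else 0) v'i /\
    rnorm (v'i - v i) <= e / (n.+1%:R * (G + 1)).
  by have [w h1 h2] := hc i; exists w.
pose E (i : 'I_n.+1) := c @^-1` [set (i : nat)].
have mE (i : 'I_n.+1) : measurable (E i) by exact: fsimple_preimage.
have memE (i : 'I_n.+1) t : (t \in E i) = (c t == i).
  by apply/idP/eqP => [/set_mem//|h]; apply/mem_set.
pose g (i : 'I_n.+1) t := if t \in D then
  (if t \in E i then n.+1%:R%:C *: u i t else 0) else 0.
pose d := \sum_i (v' i - v i).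
have dn : rnorm d <= e / (G + 1).
  apply: (le_trans (rnorm_sum _ _ _)).
  apply: (@le_trans _ _ (\sum_(i < n.+1) e / (n.+1%:R * (G + 1)))).
    by apply: ler_sum => i _; exact: (hv' i).2.
  rewrite sumr_const card_ord -[leLHS]mulr_natl.
  have N0 : n.+1%:R != 0 :> R by rewrite pnatr_eq0.
  have G1 : G + 1 != 0 by rewrite gt_eqF// ltr_wpDl.
  by rewrite le_eqVlt; apply/orP; left; apply/eqP; move: (n.+1%:R : R) N0 => a a0; field; rewrite a0 G1.
(* An element of [H] because [S t1 d] is in the domain of [A]; its representative [Q y'] is the
   state left at time [L]. *)
pose y' := mu *: S t1 d - A (S t1 d).
have Qy' : Q y' = S t1 d by case: AQ => _ _; apply.
exists g, y'; split.
- move=> i; apply: sm_if => //; last by apply: sm_simple; exact: fsimple_cst.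
  rewrite setTI; apply: sm_if => //; last by apply: sm_simple; exact: fsimple_cst.
  apply: (sm_sub (@subIsetl _ D (E i))).
  apply: (@sm_comp _ _ _ (fun x : U_ i => n.+1%:R%:C *: x)) (su i).
  exact: scaler_continuous.
- split=> [t|i t t0].
    have ct : (c t < n.+1)%N by rewrite ltnS.
    exists (Ordinal ct) => j jc; rewrite /g memE; case: ifP => // _.
    by case: eqP => // h; move: jc; rewrite -val_eqE/= h eqxx.
  rewrite /g memNset// /D/= in_itv/= => /andP[t0' _].
  by move: (lt_le_trans t0' t0); rewrite ltxx.
- move=> i; rewrite /g energy_restrict setTI energy_restrict.
  have mDE : measurable (D `&` E i) by exact: measurableI.
  have suE := sm_sub (@subIsetl _ D (E i)) (su i).
  have := @energy_le _ _ _ (D `&` E i) (u i) (fun t => n.+1%:R%:C *: u i t) n.+1%:R.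
  move=> /(_ mDE (ler0n _ _) suE) h; apply: (le_trans (h _ _)).
  + apply: (@sm_comp _ _ _ (fun x : U_ i => n.+1%:R%:C *: x)) suE.
    exact: scaler_continuous.
  + by move=> t _; rewrite rnormZr normr_nat.
  + have -> : n.+1%:R * C * rnorm y = n.+1%:R * (C * rnorm y) by rewrite mulrA.
    rewrite [X in (_ <= X%:E)%E]exprMn [X in (_ <= X)%E]EFinM; apply: lee_wpmul2l.
      by rewrite lee_fin sqr_ge0.
    by apply: le_trans (eu i); apply: energyS => //; exact: subIsetl.
- apply: (le_trans (rnormB _ _)); rewrite rnormZ -/m.
  apply: (@le_trans _ _ (G * rnorm d)).
    by rewrite mulrDl lerD// -mulrA ler_wpM2l.
  apply: (le_trans (ler_wpM2l G0 dn)).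
  by rewrite mulrCA ler_piMr ?(ltW e0)// ler_pdivrMr ?mul1r ?lerDl// ltr_wpDl.
(* The free second half applies [S t1] to the integral over the first half. *)
have w1 i := weak_integral_op mD (semigroup_bounded A_gen (ltW t10)) (hv' i).1.
have w2 := weak_integral_sum (index_enum _) mD w1.
pose F s := if s \in D then \sum_(i < n.+1) (S t1 \o (fun t => if c t == i then n.+1%:R%:C *: f i t else 0)) s else 0.
have mL : measurable (`[0, L[%classic : set R) by exact: measurable_itv.
have DL : `[0, L[%classic `&` D = D.
  apply: setIidr => s; rewrite /D/= !in_itv/= => /andP[/ltW -> st]/=.
  by rewrite (lt_le_trans st)// Lt lerDl ltW.
have w3 : weak_integral `[0, L[ F (\sum_i S t1 (v' i)).
  by apply: weak_integral_restrict => //; rewrite DL.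
have -> : Q y' - S L (Q y) = \sum_i S t1 (v' i).
  rewrite Qy' Lt (semigroupD A_gen _ (ltW t10) (ltW t10)).
  have -> : S t1 (Q y) = - \sum_i v i by rewrite sumv opprK.
  rewrite (op_linN _ (Sl (ltW t10))) opprK -(op_linD _ _ (Sl (ltW t10))).
  by rewrite /d sumrB subrK (op_lin_sum _ _ _ (Sl (ltW t10))).
apply: weak_integral_eq w3 => // s sL; rewrite /F /flow /g.
case: ifPn => [/set_mem Ds|_].
  have /andP[s0 st] := DI _ Ds.
  apply: eq_bigr => i _ /=; rewrite memE; case: ifP => _.
    have [bl _] := b_bounded i.
    have ts : 0 <= t1 - s by rewrite subr_ge0 ltW.
    rewrite (op_linZ _ _ bl) Lt -addrA (semigroupD A_gen _ (ltW t10) ts).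
    by rewrite (op_linZ _ _ (Sl ts)).
  have Ls : 0 <= L - s by rewrite Lt -addrA addr_ge0 ?(ltW t10)// subr_ge0 ltW.
  by rewrite (op_lin_zero (Sl (ltW t10))) (op_lin_zero (b_bounded i).1) (op_lin_zero (Sl Ls)).
apply/esym/big1 => i _; have Ls : 0 <= L - s.
  by move: sL; rewrite /= in_itv/= subr_ge0 => /andP[_ /ltW].
by rewrite (op_lin_zero (b_bounded i).1) (op_lin_zero (Sl Ls)).
Qed.

End SwitchingStep.

(** * Concatenation of switching steps on intervals accumulating at the final time *)

Section SwitchingControl.
Variables (R : realType) (H : hilbertType R) (A : ddop H) (S : R -> H -> H).
Hypothesis A_gen : generates_analytic (dom A) (fun x => - A x) S.
Variables (mu : R[i]) (Q : H -> H).
Hypothesis AQ : resolvent_at A mu Q.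
Variables (n : nat) (U_ : 'I_n.+1 -> hilbertType R) (b : forall i, U_ i -> H).
Hypothesis b_bounded : forall i, bounded_op (@b i).
Local Notation leb := (@lebesgue_measure R).

(** Monotone convergence; it makes the contribution of the controls after [t_ k] tend to 0. *)
Lemma rintegral_itv_cvg (h : R -> R) (T : R) (t_ : nat -> R) :
  (forall t, 0 <= h t) -> nondecreasing_seq t_ ->
  \bigcup_k `[0, t_ k[%classic = `[0, T[%classic ->
  rintegrable `[0, T[ h ->
  rintegral `[0, t_ k[ h @[k --> \oo] --> rintegral `[0, T[ h.
Proof.
move=> h0 tnd tT hi.
have mI (a : R) : measurable (`[0, a[%classic : set R) by exact: measurable_itv.
have sub k : `[0, t_ k[%classic `<=` (`[0, T[%classic : set R).
  by move=> s hs; rewrite -tT; exists k.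
have hk k : rintegrable `[0, t_ k[ h by exact: rintegrableS (mI T) (mI _) (sub k) hi.
have := @ge0_nondecreasing_set_cvg_integral _ (measurableTypeR R) R (fun k => `[0, t_ k[%classic)
  (EFin \o h) leb.
rewrite tT => cv; have /fine_cvgP[] : (\int[leb]_(x in `[0%R, t_ k[) (h x)%:E)%E
    @[k --> \oo] --> (rintegral `[0, T[ h)%:E; last by [].
rewrite EFin_rintegral//; apply: cv => //.
- move=> j k jk; apply/subsetPset => s /=; rewrite !in_itv/= => /andP[-> sj]/=.
  by rewrite (lt_le_trans sj)// tnd.
- by move=> k; apply/measurable_EFinP; exact: rintegrable_meas (hk k).
- by move=> k s _; rewrite lee_fin.
Qed.

Lemma switching_null_control : null_controllable S Q b -> forall T y0, 0 < T ->
  exists v : forall i, R -> U_ i,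
    [/\ forall i, strongly_measurable `[0, T[ (v i), switching v,
        forall i, (energy `[0%R, T[ (v i) < +oo)%E &
        weak_integral `]0, T[ (flow S b v T) (- S T (Q y0))].
Proof.
move=> nc T y0 T0.
pose p k : R := (2^-1) ^+ k.
have p0 k : 0 < p k by rewrite exprn_gt0// invr_gt0.
have pS k : p k = 2 * p k.+1 by rewrite /p exprS mulrA mulfV ?mul1r.
have p1 k : p k <= 1.
  by rewrite exprn_ile1 ?invr_ge0// invf_le1// ler1n.
have p_cvg : p k @[k --> \oo] --> 0.
  by apply: cvg_expr; rewrite ger0_norm// invf_lt1// ltr1n.
pose t_ k := T * (1 - p k).
pose L k := T * p k.+1.
have L0 k : 0 < L k by rewrite mulr_gt0.
have t0 : t_ 0%N = 0 by rewrite /t_ /p expr0 subrr mulr0.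
have tS k : t_ k.+1 = t_ k + L k by rewrite /t_ /L (pS k); ring.
have t_ge0 k : 0 <= t_ k by rewrite mulr_ge0 ?(ltW T0)// subr_ge0.
have t_ltT k : t_ k < T by rewrite gtr_pMr// ltrBlDr ltrDl.
have t_nd : nondecreasing_seq t_.
  by apply/nondecreasing_seqP => k; rewrite tS lerDl ltW.
pose I k : set R := `[t_ k, t_ k.+1[%classic.
pose J (a : R) : set R := `[0, a[%classic.
have mI k : measurable (I k) by exact: measurable_itv.
have mJ a : measurable (J a) by exact: measurable_itv.
have fJ a : finite_domain (J a).
  split => //; rewrite lebesgue_measure_itv/=.
  by case: ifP => _; rewrite -?EFinB ltry.
have Ncov s : s < T -> exists k, s < t_ k.
  move=> sT; have d0 : 0 < (T - s) / T by rewrite divr_gt0// subr_gt0.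
  move/cvgrPdist_lt : p_cvg => /(_ _ d0)[N _ /(_ N (leqnn N))/=].
  rewrite sub0r normrN ger0_norm ?(ltW (p0 N))// ltr_pdivlMr// => h.
  by exists N; rewrite /t_ mulrBr mulr1 ltrBrDl -ltrBrDr mulrC.
have cov s : 0 <= s < T -> exists k, I k s.
  move=> /andP[s0 /Ncov ex]; have [m sm mmin] := ex_minnP ex.
  case: m sm mmin => [|m] sm mmin; first by move: sm; rewrite t0 ltNge s0.
  exists m; rewrite /I/= in_itv/= sm andbT leNgt; apply/negP => /mmin.
  by rewrite ltnn.
have covJ : \bigcup_k J (t_ k) = J T.
  apply/seteqP; split=> [s [k _]|s]; rewrite /J/= !in_itv/= => /andP[s0 sk].
    by rewrite s0 (lt_trans sk).
  by have [k hk] := Ncov s sk; exists k => //=; rewrite in_itv/= s0.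
have Iinj j k s : I j s -> I k s -> j = k.
  have lt j' k' : I j' s -> I k' s -> (k' <= j')%N.
    rewrite /I/= !in_itv/= => /andP[_ h1] /andP[h2 _]; rewrite leqNgt.
    by apply/negP => /t_nd h; move: (lt_le_trans h1 (le_trans h h2)); rewrite ltxx.
  by move=> h1 h2; apply/eqP; rewrite eqn_leq !lt.
have covI : \bigcup_k I k = J T.
  apply/seteqP; split=> [s [k _]|s]; rewrite /I /J/= !in_itv/=.
    move=> /andP[h1 h2]; rewrite (le_trans (t_ge0 k) h1)/=.
    exact: lt_trans (t_ltT k.+1).
  by move=> /cov[k hk]; exists k.
have tI : trivIset setT I by move=> j k _ _ [s [h1 h2]]; exact: Iinj h1 h2.
have /choice[C hC] k : exists C, 0 <= C /\ forall y e, 0 < e ->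
    exists g : forall i, R -> U_ i, exists y',
    [/\ forall i, strongly_measurable setT (g i),
        switching g /\ (forall i t, t <= 0 -> g i t = 0),
        forall i, (energy setT (g i) <= ((C * rnorm y) ^+ 2)%:E)%E,
        rnorm y' <= e &
        weak_integral `[0, L k[ (flow S b g (L k)) (Q y' - S (L k) (Q y))].
  by have [C C0 hC] := switching_step A_gen AQ b_bounded nc (L0 k); exists C.
(* Bounds by [p k.+1] both the next state, thanks to the 1, and the cost of the next step. *)
pose e_ k := p k.+1 / (1 + C k.+1).
have C1 k : 0 < 1 + C k by rewrite ltr_pwDl//; have [] := hC k.
have e0 k : 0 < e_ k by rewrite divr_gt0.
have /choice[Phi hPhi] (ky : nat * H) : exists gy : (forall i, R -> U_ i) * H,
    [/\ forall i, strongly_measurable setT (gy.1 i),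
        switching gy.1 /\ (forall i t, t <= 0 -> gy.1 i t = 0),
        forall i, (energy setT (gy.1 i) <= ((C ky.1 * rnorm ky.2) ^+ 2)%:E)%E,
        rnorm gy.2 <= e_ ky.1 &
        weak_integral `[0, L ky.1[ (flow S b gy.1 (L ky.1))
          (Q gy.2 - S (L ky.1) (Q ky.2))].
  by have [_ /(_ ky.2 _ (e0 ky.1))[g [y' h]]] := hC ky.1; exists (g, y').
pose z := fix z k := if k is k'.+1 then (Phi (k', z k')).2 else y0.
pose G k := (Phi (k, z k)).1.
have hG k := hPhi (k, z k).
have z_le k : rnorm (z k.+1) <= p k.+1 /\ C k.+1 * rnorm (z k.+1) <= p k.+1.
  have [_ _ _ /= h _] := hG k; have [C0 _] := hC k.+1.
  have e_le : e_ k <= p k.+1.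
    by rewrite ler_pdivrMr// ler_peMr ?(ltW (p0 _))// lerDl.
  split; first exact: le_trans e_le.
  apply: (le_trans (ler_wpM2l C0 h)); rewrite /e_ mulrCA ler_piMr ?(ltW (p0 _))//.
  by rewrite ler_pdivrMr// mul1r lerDr.
(* The index of the interval containing [s]. The default 0 outside [[0, T[] is harmless: each [G k]
   is switching at all times, hence so is [v]. *)
pose kap s := xget 0%N [set k | I k s].
have kapE k s : I k s -> kap s = k.
  move=> Iks; apply: (Iinj _ _ s _ Iks).
  exact: (xgetPex 0%N (ex_intro (fun k => I k s) k Iks)).
pose v i s := G (kap s) i (s - t_ (kap s)).
have vE k s i : I k s -> v i s = G k i (s - t_ k) by move=> /kapE h; rewrite /v h.
have smI k i : strongly_measurable (I k) (v i).
  have [h _ _ _ _] := hG k.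
  have /(sm_sub (subsetT (I k))) : strongly_measurable setT
      (fun s => G k i (s + - t_ k)).
    by have := sm_shift (- t_ k) (h i); rewrite preimage_setT.
  by apply: sm_eq => s Is; rewrite (vE k).
have smv i : strongly_measurable (J T) (v i).
  by rewrite -covI; exact: sm_bigcup.
have JS a c : a <= c -> J a `<=` J c.
  by move=> ac s; rewrite /J/= !in_itv/= => /andP[-> h]/=; exact: lt_le_trans ac.
have JT k : J (t_ k) `<=` J T by apply: JS; exact: ltW.
have enI k i : (energy (I k) (v i) <= ((C k * rnorm (z k)) ^+ 2)%:E)%E.
  have [h _ /(_ i) h2 _ _] := hG k; apply: le_trans h2 => /=.
  have hs := sm_shift (- t_ k) (h i).
  rewrite -[leRHS](energy_shift (- t_ k) _ (h i))//.
  rewrite (energy_eq (v := fun s => G k i (s + - t_ k))); last first.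
    by move=> s Is; rewrite (vE k).
  by apply: energyS => //; exact: (measurable_shift (- t_ k) measurableT).
(* The square pays for the first step, whose initial state is not small; the 1 suffices for all the
   others. *)
pose Kb := 1 + (C 0%N * rnorm y0) ^+ 2.
have Kb1 : 1 <= Kb by rewrite lerDl sqr_ge0.
have incr k : (C k * rnorm (z k)) ^+ 2 <= Kb * p k.
  case: k => [|k]; first by rewrite /p expr0 mulr1 lerDr.
  have [_ h] := z_le k; have [C0 _] := hC k.+1.
  have h0 : 0 <= C k.+1 * rnorm (z k.+1) by rewrite mulr_ge0 ?rnorm_ge0.
  have := p1 k.+1; have := p0 k.+1; nra.
have JU k : J (t_ k.+1) = J (t_ k) `|` I k.
  apply/seteqP; split=> s; rewrite /J /I/= !in_itv/=.
    move=> /andP[-> h]; rewrite h andbT/=; have [sk|sk] := ltP s (t_ k); [by left|by right].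
  move=> [/andP[-> h]|/andP[h ->]]/=; last by rewrite andbT; exact: le_trans h.
  by rewrite (lt_le_trans h)// t_nd.
have JI k : J (t_ k) `&` I k = set0.
  apply/seteqP; split=> // s []; rewrite /J /I/= !in_itv/= => /andP[_ h1] /andP[h2 _].
  by move: (lt_le_trans h1 h2); rewrite ltxx.
(* [2 * (1 - p k)] is the sum of [p j] over [j < k]. *)
have enJ k i : (energy (J (t_ k)) (v i) <= (2 * Kb * (1 - p k))%:E)%E.
  elim: k => [|k ih].
    rewrite /energy (_ : J (t_ 0%N) = set0) ?integral_set0.
      by rewrite lee_fin mulr_ge0 ?subr_ge0// mulr_ge0// (le_trans ler01).
    apply/seteqP; split=> // s; rewrite /J/= t0 in_itv/= => /andP[h1 h2].
    by move: (le_lt_trans h1 h2); rewrite ltxx.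
  rewrite /energy JU (@ge0_integral_setU _ _ _ leb _ _ (mJ _) (mI k)) => //; first last.
  - by apply/disj_setPLR; apply/disjoints_subset.
  - by move=> s _; rewrite lee_fin sqr_ge0.
  - apply: measurable_sqr_rnorm; rewrite -JU; exact: sm_sub (JT _) (smv i).
  apply: (le_trans (leeD ih (enI k i))); rewrite -EFinD lee_fin.
  have := incr k; rewrite (pS k); move: (p k.+1) => q; lra.
have env i : (energy (J T) (v i) < +oo)%E.
  have cv := @ge0_nondecreasing_set_cvg_integral _ (measurableTypeR R) R (fun k => J (t_ k))
    (fun s => (rnorm (v i s) ^+ 2)%:E) leb.
  have {}cv : energy (J (t_ k)) (v i) @[k --> \oo] --> energy (J T) (v i).
    rewrite -covJ; apply: cv => //.
    - by move=> j k jk; apply/subsetPset; apply: JS; exact: t_nd.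
    - by move=> k; exact: mJ.
    - move=> k; apply: measurable_sqr_rnorm; exact: sm_sub (JT k) (smv i).
    - by move=> k s _; rewrite lee_fin sqr_ge0.
  apply: (@le_lt_trans _ _ (2 * Kb)%:E); last exact: ltry.
  apply: (cvge_to_le cv); apply: nearW => k.
  apply: (le_trans (enJ k i)); rewrite lee_fin.
  have := p0 k; nra.
have fsm D t : measurable D -> D `<=` J T -> (forall s, D s -> s < t) ->
    strongly_measurable D (flow S b v t).
  move=> mD DT Dt; apply: (flow_sm A_gen b_bounded) => //.
    by move=> s Ds; rewrite Dt// andbT; have /andP[] : 0 <= s < T by have := DT _ Ds; rewrite /J/= in_itv.
  by move=> i; exact: sm_sub DT (smv i).
have fint D t : measurable D -> D `<=` J T -> (forall s, D s -> s < t) ->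
    rintegrable D (fun s => rnorm (flow S b v t s)).
  move=> mD DT Dt; apply: (flow_integrable A_gen b_bounded) => //.
  - exact: finite_domainS mD DT (fJ T).
  - by move=> s Ds; rewrite Dt// andbT; have /andP[] : 0 <= s < T by have := DT _ Ds; rewrite /J/= in_itv.
  - by move=> i; exact: sm_sub DT (smv i).
  - by move=> i; apply: le_lt_trans (env i); exact: energyS.
have frin D t x : measurable D -> D `<=` J T -> (forall s, D s -> s < t) ->
    rintegrable D (fun s => rinner (flow S b v t s) x).
  by move=> mD DT Dt; apply: rintegrable_rinner => //; [exact: fsm|exact: fint].
have flowS s t r : 0 <= s < t -> 0 <= r ->
    flow S b v (t + r) s = S r (flow S b v t s).
  move=> /andP[s0 st] r0; have Sr := semigroup_linear A_gen r0.
  rewrite /flow (op_lin_sum _ _ _ Sr); apply: eq_bigr => i _.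
  rewrite -(semigroupD A_gen)// ?subr_ge0 ?(ltW st)//.
  by congr (S _ _); ring.
have Jlt a s : J a s -> 0 <= s < a by rewrite /J/= in_itv.
(* The glued control brings [y0] exactly to [z k] at time [t_ k]. *)
have W k : weak_integral (J (t_ k)) (flow S b v (t_ k)) (Q (z k) - S (t_ k) (Q y0)).
  elim: k => [|k ih].
    rewrite t0 (semigroup0 A_gen) subrr; apply: weak_integral0 => // s.
    by move=> /Jlt/andP[h1 h2]; move: (le_lt_trans h1 h2); rewrite ltxx.
  have Lk0 := ltW (L0 k); have SL := semigroup_linear A_gen Lk0.
  have w1 : weak_integral (J (t_ k)) (flow S b v (t_ k.+1))
      (S (L k) (Q (z k) - S (t_ k) (Q y0))).
    apply: weak_integral_eq (weak_integral_op (mJ _) (semigroup_bounded A_gen Lk0) ih) => //.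
    by move=> s /Jlt st /=; rewrite tS flowS.
  have w2 : weak_integral (I k) (flow S b v (t_ k.+1))
      (Q (z k.+1) - S (L k) (Q (z k))).
    have [_ _ _ _ h] := hG k.
    have eI : (fun s => s + - t_ k) @^-1` `[0, L k[%classic = I k.
      apply/seteqP; split=> s; rewrite /I/= !in_itv/= tS.
        by rewrite subr_ge0 ltrBlDl.
      by rewrite subr_ge0 ltrBlDl.
    have := weak_integral_shift (- t_ k) (mJ (L k)) h; rewrite eI.
    apply: weak_integral_eq => // s Is; rewrite /flow; apply: eq_bigr => i _.
    by rewrite (vE k)// tS; congr (S _ _); ring.
  have := weak_integral_setU (mJ _) (mI k) (JI k) w1 w2.
  rewrite -JU => h; have {}h := h (fun x => frin (J (t_ k.+1)) _ x (mJ _) (JT _)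
    (fun s Js => proj2 (andP (Jlt _ _ Js)))); move: h.
  rewrite (op_linB _ _ SL) addrC addrA subrK.
  by rewrite -(semigroupD A_gen)// [L k + _]addrC -tS.
have wV : weak_integral (J T) (flow S b v T) (- S T (Q y0)).
  have [V /(bochner_weak (fJ T)) wV] := bochner_exists (fJ T)
    (fsm (J T) T (mJ T) (@subset_refl _ _) (fun s h => proj2 (andP (Jlt _ _ h))))
    (fint (J T) T (mJ T) (@subset_refl _ _) (fun s h => proj2 (andP (Jlt _ _ h)))).
  suff -> : - S T (Q y0) = V by [].
  apply/eqP; rewrite eq_sym -subr_eq0 opprK -rnorm_eq0 eq_le rnorm_ge0 andbT.
  have [M M0 hM] := semigroup_bound A_gen T.
  have [K K0 hK] := bounded_op_norm (resolvent_bounded AQ).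
  pose h s := rnorm (flow S b v T s).
  have hi : rintegrable (J T) h.
    by apply: fint => // s /Jlt/andP[].
  pose B k : set R := `[t_ k, T[%classic.
  have mB k : measurable (B k) by exact: measurable_itv.
  have BT k : B k `<=` J T.
    move=> s; rewrite /B /J/= !in_itv/= => /andP[h1 ->]; rewrite andbT.
    exact: le_trans h1.
  have Blt k s : B k s -> s < T by rewrite /B/= in_itv/= => /andP[].
  have JB k : J T = J (t_ k) `|` B k.
    apply/seteqP; split=> s; last by case=> [/JT|/BT].
    rewrite /J /B/= !in_itv/= => /andP[-> sT]; rewrite sT andbT/=.
    by have [sk|sk] := ltP s (t_ k); [left|right].
  have JB0 k : J (t_ k) `&` B k = set0.
    apply/seteqP; split=> // s []; rewrite /J /B/= !in_itv/= => /andP[_ h1] /andP[h2 _].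
    by move: (lt_le_trans h1 h2); rewrite ltxx.
  (* The final state is the free evolution of [z k] from [t_ k] to [T] plus the effect of the
     controls on [[t_ k, T[], the tail of a convergent integral. The last term covers [z 0 = y0],
     which is not small. *)
  have bound k : rnorm (V + S T (Q y0)) <=
      M * (K * p k) + (rintegral (J T) h - rintegral (J (t_ k)) h) + (k == 0%N)%:R * (M * (K * rnorm y0)).
    have Tk0 : 0 <= T - t_ k by rewrite subr_ge0 ltW.
    have ST := semigroup_linear A_gen Tk0.
    have w1 : weak_integral (J (t_ k)) (flow S b v T)
        (S (T - t_ k) (Q (z k) - S (t_ k) (Q y0))).
      apply: weak_integral_eq (weak_integral_op (mJ _) (semigroup_bounded A_gen Tk0) (W k)) => //.
      by move=> s /Jlt st /=; rewrite -flowS// subrKC.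
    have fB : finite_domain (B k) by exact: finite_domainS (mB k) (BT k) (fJ T).
    have [X /(bochner_weak fB) wX] := bochner_exists fB
      (fsm _ T (mB k) (BT k) (Blt k)) (fint _ T (mB k) (BT k) (Blt k)).
    have := weak_integral_setU (mJ _) (mB k) (JB0 k) w1 wX.
    rewrite -JB => w2; have {}w2 := w2 (fun x => frin _ T x (mJ T) (@subset_refl _ _)
      (fun s Js => proj2 (andP (Jlt _ _ Js)))).
    rewrite (weak_integral_uniq wV w2) (op_linB _ _ ST).
    rewrite -(semigroupD A_gen)// subrK addrAC subrK.
    have hX : rnorm X <= rintegral (J T) h - rintegral (J (t_ k)) h.
      rewrite (JB k) rintegral_setU// -?JB// addrAC subrr add0r.
      by apply: (weak_integral_norm (mB k) wX) => //; exact: (fint _ T (mB k) (BT k) (Blt k)).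
    have hz : rnorm (z k) <= p k + (k == 0%N)%:R * rnorm y0.
      case: k {Tk0 ST w1 fB wX w2 hX} => [|k] /=.
        by rewrite mul1r lerDr ltW.
      by rewrite mul0r addr0; have [] := z_le k.
    apply: (le_trans (rnormD _ _)).
    have : rnorm (S (T - t_ k) (Q (z k))) <= M * (K * (p k + (k == 0%N)%:R * rnorm y0)).
      apply: (le_trans (hM _ _ _)); first by rewrite Tk0/= lerBlDr lerDl.
      by rewrite ler_wpM2l// (le_trans (hK _))// ler_wpM2l.
    lra.
  have cvb : M * (K * p k) + (rintegral (J T) h - rintegral (J (t_ k)) h)
      @[k --> \oo] --> M * (K * 0) + (rintegral (J T) h - rintegral (J T) h).
    apply: cvgD.
      apply: cvgM; first exact: cvg_cst.
      by apply: cvgM => //; exact: cvg_cst.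
    apply: cvgB; first exact: cvg_cst.
    by apply: rintegral_itv_cvg => // s; exact: rnorm_ge0.
  rewrite !mulr0 subrr addr0 in cvb.
  apply: (cvgr_to_ge cvb); exists 1%N => // k /= k1.
  by have := bound k; rewrite eqn0Ngt k1 mul0r addr0.
have mT : measurable (`]0, T[%classic : set R) by exact: measurable_itv.
have sT : `]0, T[%classic `<=` J T.
  by move=> s; rewrite /J/= !in_itv/= => /andP[/ltW -> ->].
have ltT s : `]0, T[%classic s -> s < T by rewrite /= in_itv/= => /andP[].
have fT : finite_domain (`]0, T[%classic : set R) by exact: finite_domain_itv.
exists v; split=> //.
  move=> t; have [_ [sw _] _ _ _] := hG (kap t).
  by have [i0 h] := sw (t - t_ (kap t)); exists i0.
have [V /(bochner_weak fT) wV'] := bochner_exists fT (fsm _ T mT sT ltT) (fint _ T mT sT ltT).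
suff -> : - S T (Q y0) = V by [].
apply: (weak_integral_uniq wV).
(* The gluing uses intervals closed on the left, the conclusion an open one. The integrand vanishes
   at [s = 0], because every [G k] vanishes at non-positive times. *)
have := weak_integral_restrict (mJ T) mT (_ : weak_integral (J T `&` `]0, T[%classic) _ _).
rewrite (setIidr sT) => /(_ _ _ _ wV'); apply: weak_integral_eq => // s /Jlt/andP[s0 sT'].
case: ifPn => // sn; rewrite /flow big1// => i _.
have -> : v i s = 0.
  have [_ [_ v0] _ _ _] := hG (kap s); apply: v0.
  rewrite subr_le0; suff -> : s = 0 by [].
  apply/eqP; rewrite eq_le s0 andbT leNgt; apply/negP => s0'.
  by move/negP : sn; apply; rewrite inE/= in_itv/= s0'.
have [bl _] := b_bounded i.
by rewrite (op_lin_zero bl) (op_lin_zero (semigroup_linear A_gen _))// subr_ge0 ltW.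
Qed.

End SwitchingControl.

(** * Return to the control system in D(A^* )' *)

(** The components of the inverse of [p] are linear by injectivity of [p]; the lower norm estimate,
    with constant [c], bounds each of them by [1 / c]. *)
Lemma product_components (R : realType) (n : nat)
    (U : 'I_n -> normedModType R[i]) (V : normedModType R[i])
    (p : (forall i, U i) -> V) : product_isomorphism p ->
  exists2 q : V -> forall i, U i, cancel q p &
    (forall i, linear (fun x => q x i)) /\
    exists2 c : R, 0 <= c & forall i x, rnorm (q x i) <= c * rnorm x.
Proof.
move=> [plin [q pK qK] [c [C [c0 pbnd]]]]; exists q => //; split.
  move=> i a x y; suff -> : q (a *: x + y) = fun i => a *: q x i + q y i by [].
  by apply: (can_inj pK); rewrite plin !qK.
exists c^-1 => [|i x]; first by rewrite invr_ge0 ltW.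
rewrite -ler_pdivrMl ?invr_gt0// invrK.
have /andP[+ _] := pbnd (q x); rewrite qK.
under eq_bigr do rewrite rnormE.
rewrite -rmorph_sum/= rnormE -rmorphM lecR; apply: le_trans.
rewrite ler_wpM2l ?(ltW c0)// (bigD1 i)//= lerDl.
by apply: sumr_ge0 => j _; exact: rnorm_ge0.
Qed.

Theorem theorem5p1 (R : realType) (H : hilbertType R) (A : ddop H)
  (* e^{-tA}, e^{-tA^*} and the extension of e^{-tA} to D(A^* )' *)
  (S Sadj : R -> H -> H) (Sext : R -> dual_dom_adj A -> dual_dom_adj A)
  (A_res : compact_resolvent A)
  (A_gen : generates_analytic (dom A) (fun x => - A x) S)
  (Aadj_gen : generates (dom_adj A) (fun x => - adj A x) Sadj)
  (S_ext : extends_semigroup S Sext)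
  (* the spectral decomposition of A^*, with A_k^* = lam k + N k on Hk k *)
  (Hk : nat -> set H) (lam : nat -> R[i]) (N P : nat -> H -> H)
  (lam_inj : injective lam)
  (lam_spec : forall mu, is_eigenvalue (dom_adj A) (adj A) mu <->
                         exists k, mu = lam k)
  (Hk_eigen : forall k,
     Hk k = generalized_eigenspace (dom_adj A) (adj A) (lam k))
  (Hk_fin : forall k, finite_dimensional (Hk k))
  (Hk_sum : direct_sum_decomposition Hk)
  (Hk_stable : forall k x, Hk k x -> dom_adj A x /\ Hk k (adj A x))
  (N_nilp : forall k, nilpotent_on (Hk k) (N k))
  (Hk_adj : forall k x, Hk k x -> adj A x = lam k *: x + N k x)
  (lam_homo : forall j k, (j <= k)%N ->
     complex.Re (lam j) <= complex.Re (lam k))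
  (lam_oo : complex.Re (lam k) @[k --> \oo] --> +oo)
  (P_proj : forall k,
     projection_along (Hk k) (oplus Hk [set j | j != k]) (P k))
  (Sadj_series : exists2 t0 : R, 0 < t0 & forall t, t0 <= t ->
     norm_cvg (fun n x => \sum_(0 <= k < n)
                 exp_op (fun z => lam k *: z + N k z) (- t) (P k x))
              (Sadj t))
  (* the control operators *)
  (U : hilbertType R) (B : U -> dual_dom_adj A) (B_bd : bounded_op B)
  (n : nat) (n_ge2 : (2 <= n)%N)
  (U_ : 'I_n -> hilbertType R) (p : (forall i, U_ i) -> U)
  (p_iso : product_isomorphism p)
  (B_ : forall i, U_ i -> dual_dom_adj A)
  (B_i_bd : forall i, bounded_op (B_ i))
  (B_i_sum : forall u : forall i, U_ i, B (p u) = \sum_i B_ i (u i))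
  (nullc : null_controllable_small_times Sext B) :
  forall (T : R) (y0 : H), 0 < T ->
  exists u : forall i, R -> U_ i,
    [/\ forall i, L2fun T (u i),
        exists2 y, mild_solution Sext T y0 (fun t => \sum_i B_ i (u i t)) y
                   & y T = 0
      & {ae @lebesgue_measure R, forall t, 0 < t < T ->
          \prod_i (\sum_(j | j != i) `|u j t|) = 0}].
Proof.
move=> T y0 T0; case: n n_ge2 U_ p p_iso B_ B_i_bd B_i_sum => // n' _ U' p' p_iso' B' B_bd' B_sum'.
have [mu [Q [AQ _]]] := A_res.
have [K Kb [JK KJ]] := dual_embedding_inverse AQ.
set J := dual_embedding _ _ in JK KJ.
have Jb : bounded_op J by exact: dual_embedding_bounded.
have [Jl _] := Jb; have [Kl _] := Kb.
have SextJ t h : 0 <= t -> Sext t (J h) = J (S t h).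
  exact: (dual_embedding_semigroup AQ _ A_gen S_ext).
have pivE h : pivot A h = J (Q h) by exact: pivotE.
have [q qK [ql [c c0 qc]]] := product_components p_iso'.
(* The control operators read in the copy of [H], where they become bounded into [H]. *)
pose b i (x : U' i) : H := K (B' i x).
have bb i : bounded_op (@b i) by exact: bounded_op_comp (B_bd' i) Kb.
have Jb_sum (w : forall i, U' i) : \sum_i B' i (w i) = J (\sum_i b i (w i)).
  by rewrite (op_lin_sum _ _ _ Jl); apply: eq_bigr => i _; rewrite /b KJ.
have flowE (w : forall i, R -> U' i) t s : 0 <= s -> s <= t ->
    Sext (t - s) (\sum_i B' i (w i s)) = J (flow S b w t s).
  move=> s0 st; have ts : 0 <= t - s by rewrite subr_ge0.
  rewrite (Jb_sum (fun i => w i s)) SextJ//; congr J.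
  by rewrite (op_lin_sum _ _ _ (semigroup_linear A_gen ts)).
have qb i : bounded_op (fun x => q x i) by apply: norm_bounded_op => //; exists c.
have nc : null_controllable S Q b.
  move=> t t0; have [C' hC'] := nullc t t0.
  (* The constant of the hypothesis has no prescribed sign; only its square enters the energy
     bound. *)
  exists (c * `|C'|) => [|y]; first by rewrite mulr_ge0.
  have [u [[su _] uC [ys hys ysT]]] := hC' y.
  have suq i : strongly_measurable `]0, t[ (fun s => q (u s) i).
    by have [_ qcont] := qb i; exact: (sm_comp qcont su).
  exists (fun i s => q (u s) i); split=> //.
  - move=> i; have mI : measurable (`]0, t[%classic : set R) by exact: measurable_itv.
    apply: (le_trans (energy_le mI c0 su (suq i) (fun s _ => qc i (u s)))).
    apply: (@le_trans _ _ ((c ^+ 2)%:E * ((C' * rnorm y) ^+ 2)%:E)%E).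
      by apply: lee_wpmul2l; [rewrite lee_fin sqr_ge0|exact: L2norm_le].
    rewrite -EFinM lee_fin -!exprMn -[leLHS]real_normK ?num_real//.
    by rewrite !normrM (ger0_norm c0) (ger0_norm (rnorm_ge0 y)) mulrA.
  - have [|w hw ysE] := hys t; first by rewrite lexx ltW.
    have mI : measurable (`]0, t[%classic : set R) by exact: measurable_itv.
    have := bochner_integral_map mI Kb (can_inj KJ) hw.
    (* This is the condition that the mild solution vanishes at time [t], seen through [K]. *)
    have -> : K w = - S t (Q y).
      apply: (can_inj JK); rewrite KJ (op_linN _ Jl) -SextJ ?(ltW t0)// -pivE.
      by apply/eqP; rewrite eq_sym -subr_eq0 -opprD oppr_eq0 -ysE ysT.
    move=> /(bochner_weak (finite_domain_itv 0 t)).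
    apply: weak_integral_eq => // s; rewrite /= in_itv/= => /andP[s0 st].
    have -> : B (u s) = \sum_i B' i (q (u s) i) by rewrite -B_sum' qK.
    by rewrite (flowE (fun i s => q (u s) i)) ?(ltW s0) ?(ltW st)// JK.
have [v [smv sw env wT]] := switching_null_control A_gen AQ bb nc y0 T0.
have sub (t : R) : t <= T -> `]0, t[%classic `<=` (`[0, T[%classic : set R).
  by move=> tT s; rewrite /= !in_itv/= => /andP[/ltW -> h]/=; exact: lt_le_trans tT.
have mI (t : R) : measurable (`]0, t[%classic : set R) by exact: measurable_itv.
have smt t i : t <= T -> strongly_measurable `]0, t[ (v i).
  by move=> tT; exact: sm_sub (sub t tT) (smv i).
have ent t i : t <= T -> (energy `]0%R, t[ (v i) < +oo)%E.
  by move=> tT; apply: le_lt_trans (env i); apply: energyS => //; exact: sub.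
have It (t s : R) : `]0, t[%classic s -> 0 <= s < t.
  by rewrite /= in_itv/= => /andP[/ltW -> ->].
(* A mild solution needs a Bochner integral at every time up to [T]; beyond [T] the value is a dummy
   0. *)
have /choice[V hV] t : exists V, t <= T -> bochner_integral `]0, t[ (flow S b v t) V.
  have [tT|tT] := leP t T; last by exists 0.
  have [V hV] := bochner_exists (finite_domain_itv 0 t)
    (flow_sm A_gen bb (mI t) (It t) (fun i => smt t i tT))
    (flow_integrable A_gen bb (finite_domain_itv 0 t) (It t) (fun i => smt t i tT)
       (fun i => ent t i tT)).
  by exists V.
exists v; split.
- move=> i; split; first exact: smt.
  by apply/L2norm_lty; exact: ent.
- exists (fun t => Sext t (pivot A y0) + J (V t)).
    move=> t /andP[t0 tT]; exists (J (V t)) => //.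
    apply: bochner_integral_eq (bochner_integral_map (mI t) Jb (can_inj JK) (hV t tT)).
    by move=> s /It/andP[s0 st]; rewrite (flowE v)// ltW.
  have -> : V T = - S T (Q y0).
    exact: weak_integral_uniq (bochner_weak (finite_domain_itv 0 T) (hV T (lexx T))) wT.
  by rewrite pivE SextJ ?(ltW T0)// (op_linN _ Jl) subrr.
(* The factor of index [i0] vanishes: it sums the norms of all the components except the only one
   that may be active. *)
- apply: aeW => t _; have [i0 hi0] := sw t.
  rewrite (bigD1 i0)//= big1 ?mul0r// => j ji.
  by rewrite hi0// normr0.
Qed.
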